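(* For $p,q>0$ and $s=p+q$, let $$\Psi(p,q)=2s^3(s+1)+pq\bigl(s^3-7s^2-16s-12\bigr).$$ The set $\{(p,q)\in(0,\infty)^2:\Psi(p,q)<0\}$ contains a nonempty open subset $U$ of $\mathbb{R}^2$ such that every $(p,q)\in U$ satisfies: it is not the case that both $p\le 1$ and $q\le 1$; $p\notin I$ and $q\notin I$; $p\neq q$; and $p+q\neq 2$. In particular, $\beta_{41/50,\,32/25}$ is not freely infinitely divisible. Moreover, $\kappa_4(\beta_{41/50,\,32/25})>0$.
   Context: For $p,q>0$, $\beta_{p,q}$ denotes the beta distribution on $[0,1]$ with density $x^{p-1}(1-x)^{q-1}/B(p,q)$ on $(0,1)$, where $B$ is the Euler beta function. The set $I\subset\mathbb{R}$ is $$I=\bigcup_{n\geq1}\left(\frac{2n-1}{2n},\frac{2n}{2n+1}\right)\cup\bigcup_{n\geq1}\left(\frac{2n+2}{2n+1},\frac{2n+1}{2n}\right).$$ The previously known non-freely-infinitely-divisible regions are $\{0<p,q\le 1\}$ and the region where $p\in I$ or $q\in I$; the previously classified one-dimensional subfamilies are the diagonal $p=q$ and the line $p+q=2$. For a probability measure $\mu$ on $\mathbb{R}$ with finite moments $m_n(\mu)=\int x^n\,\mu(\mathrm{d}x)$, the free cumulants $\kappa_n(\mu)$, $n\ge 1$, are determined by $m_n(\mu)=\sum_{\pi\in NC(n)}\prod_{V\in\pi}\kappa_{|V|}(\mu)$ for all $n\geq 1$, where $NC(n)$ is the set of noncrossing partitions of $\{1,\dots,n\}$ and the product is over the blocks $V$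 of $\pi$. A probability measure $\mu$ on $\mathbb{R}$ is freely infinitely divisible if for every $n\in\mathbb{N}$, $n\ge1$, there is a probability measure $\mu_n$ on $\mathbb{R}$ such that $\mu$ is the $n$-fold free additive convolution power $\mu_n^{\boxplus n}$. *)

(* Defs.v *)
From HB Require Import structures.
From mathcomp Require Import all_boot all_order all_algebra.
From mathcomp Require Import complex.
From mathcomp Require Import all_classical all_reals all_analysis.
From mathcomp Require Import measurable_realfun lra.

Set Implicit Arguments.
Unset Strict Implicit.
Unset Printing Implicit Defensive.

Import Order.TTheory GRing.Theory Num.Theory.
Import numFieldNormedType.Exports.

Local Open Scope classical_set_scope.
Local Open Scope ring_scope.
Local Open Scope complex_scope.

Section noncrossing.
Local Open Scope nat_scope.
Variable n : nat.
Implicit Type P : {set {set 'I_n}}.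

Definition noncrossing P : bool :=
  [forall V in P, forall W in P, (V != W) ==>
    ~~ [exists a in V, exists b in W, exists c in V, exists d in W,
         [&& a < b, b < c & c < d]]].

Definition NC : {set {set {set 'I_n}}} :=
  [set P | finset.partition P [set: 'I_n]%SET & noncrossing P].

End noncrossing.

Section free_cumulants.
Variable R : realType.
Implicit Types m k : nat -> R.

Definition moment_cumulant_formula m k : Prop :=
  forall n, (0 < n)%N -> m n = \sum_(P in NC n) \prod_(V in P) k #|V|.

(* [:: 0; k_1; ...; k_n]: the one-block partition contributes k_n to m_n and
   every other partition only involves smaller indices. *)
Fixpoint free_cumulants_upto m (n : nat) : seq R :=
  if n is n'.+1 then
    let s := free_cumulants_upto m n' in
    rcons s (m n - \sum_(P in NC n | P != [set [set: 'I_n]]%SET)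
                     \prod_(V in P) s`_#|V|)
  else [:: 0].

Definition free_cumulant_of_moments m (n : nat) : R :=
  (free_cumulants_upto m n)`_n.

Definition moment (mu : probability (measurableTypeR R) R) (n : nat) : R :=
  \int[mu]_x (x ^+ n).

Definition free_cumulant (mu : probability (measurableTypeR R) R) :=
  free_cumulant_of_moments (moment mu).

Lemma size_free_cumulants_upto m n : size (free_cumulants_upto m n) = n.+1.
Proof. by elim: n => //= n IH; rewrite size_rcons IH. Qed.

Lemma nth_free_cumulants_upto m n j : (j <= n)%N ->
  (free_cumulants_upto m n)`_j = free_cumulant_of_moments m j.
Proof.
elim: n => [|n IH]; first by rewrite leqn0 => /eqP->.
rewrite leq_eqVlt => /predU1P[->//|]; rewrite ltnS => jn /=.
by rewrite nth_rcons size_free_cumulants_upto ltnS jn IH.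
Qed.

Lemma one_block_NC n : [set [set: 'I_n.+1]]%SET \in NC n.+1.
Proof.
rewrite inE; apply/andP; split; last first.
  apply/forall_inP => V; rewrite inE => /eqP->.
  by apply/forall_inP => W; rewrite inE => /eqP->; rewrite eqxx.
apply/and3P; split.
- by rewrite /finset.cover finset.big_set1.
- by apply/finset.trivIsetP => A B; rewrite !inE => /eqP-> /eqP->; rewrite eqxx.
- rewrite inE; apply/eqP => /finset.setP/(_ ord0); by rewrite !inE.
Qed.

Lemma card_block_lt n (P : {set {set 'I_n.+1}}) (V : {set 'I_n.+1}) :
  P \in NC n.+1 -> P != [set [set: 'I_n.+1]]%SET -> V \in P ->
  (#|V| < n.+1)%N.
Proof.
rewrite inE => /andP[Ppart _] PT VP.
have := max_card (mem V); rewrite card_ord ltn_neqAle => ->; rewrite andbT.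
apply: contra PT => /eqP cV.
have VT : V = [set: 'I_n.+1]%SET.
  by apply/eqP; rewrite finset.eqEcard finset.subsetT /= finset.cardsT card_ord cV.
have /and3P[_ /finset.trivIsetP tP P0] := Ppart.
apply/eqP/finset.setP => W; rewrite inE; apply/idP/eqP => [WP|->]; last by rewrite -VT.
have [->//|WV] := eqVneq W V.
have := tP _ _ WP VP WV; rewrite VT -setI_eq0 finset.setIT => /eqP W0.
by rewrite W0 (negbTE P0) in WP.
Qed.

Lemma moment_cumulant m :
  moment_cumulant_formula m (free_cumulant_of_moments m).
Proof.
move=> [//|n] _; rewrite (bigD1 _ (one_block_NC n)) /= finset.big_set1.
rewrite finset.cardsT card_ord {1}/free_cumulant_of_moments /=.
rewrite nth_rcons size_free_cumulants_upto ltnn eqxx.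
rewrite [X in _ - X](_ : _ = \sum_(P in NC n.+1 | P != [set [set: 'I_n.+1]]%SET)
  \prod_(V in P) free_cumulant_of_moments m #|V|) ?subrK //.
apply: eq_bigr => P /andP[PN PT]; apply: eq_bigr => V VP.
by rewrite nth_free_cumulants_upto // -ltnS (card_block_lt PN PT VP).
Qed.

Lemma moment_cumulant_unique m k : moment_cumulant_formula m k ->
  forall n, (0 < n)%N -> k n = free_cumulant_of_moments m n.
Proof.
move=> mk; elim/ltn_ind => -[//|n] IH _.
have := mk n.+1 isT; rewrite (moment_cumulant m) //.
rewrite !(bigD1 _ (one_block_NC n)) /= !finset.big_set1 finset.cardsT card_ord.
have -> : \sum_(P in NC n.+1 | P != [set [set: 'I_n.+1]]%SET) \prod_(V in P) k #|V| =
          \sum_(P in NC n.+1 | P != [set [set: 'I_n.+1]]%SET)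
  \prod_(V in P) free_cumulant_of_moments m #|V|.
  apply: eq_bigr => P /andP[PN PT]; apply: eq_bigr => V VP.
  apply: IH; first exact: card_block_lt PN PT VP.
  rewrite finset.card_gt0; apply: contraTneq VP => ->.
  by move: PN; rewrite inE => /andP[/and3P[]].
by move/addIr.
Qed.

End free_cumulants.

Section free_convolution.
Variable R : realType.
Implicit Types mu nu rho : probability (measurableTypeR R) R.

Definition cauchy_transform mu (z : R[i]) : R[i] :=
  (\int[mu]_x complex.Re ((z - x%:C)^-1)) +i*
  (\int[mu]_x complex.Im ((z - x%:C)^-1)).

Definition reciprocal_cauchy_transform mu (z : R[i]) : R[i] :=
  (cauchy_transform mu z)^-1.

Definition stolz_domain (a b : R) : set R[i] :=
  [set z | b < complex.Im z /\ `|complex.Re z| < a * complex.Im z].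

(* [z + phi z] is the right inverse of the reciprocal Cauchy transform with
   [z + phi z ~ z] at infinity in the Stolz domain.  Such a right inverse exists
   on [stolz_domain a b] for every [a] when [b] is large enough, and the
   normalization determines it for large [z]. *)
Definition voiculescu_transform_on mu (a b : R) (phi : R[i] -> R[i]) : Prop :=
  (forall z, stolz_domain a b z ->
     0 < complex.Im (z + phi z) /\
     reciprocal_cauchy_transform mu (z + phi z) = z) /\
  (forall e : R, 0 < e -> exists r : R, forall z,
     stolz_domain a b z -> r%:C < `|z| -> `|phi z| <= e%:C * `|z|).

(* [rho] is the free additive convolution of [mu] and [nu] (Bercovici and
   Voiculescu); no moment assumption. *)
Definition free_additive_convolution mu nu rho : Prop :=
  exists a b : R, exists phi_mu phi_nu phi_rho : R[i] -> R[i],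
    [/\ 0 < a /\ 0 < b,
        voiculescu_transform_on mu a b phi_mu,
        voiculescu_transform_on nu a b phi_nu,
        voiculescu_transform_on rho a b phi_rho &
        forall z, stolz_domain a b z -> phi_rho z = phi_mu z + phi_nu z].

Inductive free_convolution_power nu :
    nat -> probability (measurableTypeR R) R -> Prop :=
| free_convolution_power1 mu :
    (forall A : set (measurableTypeR R), measurable A -> mu A = nu A) ->
    free_convolution_power nu 1 mu
| free_convolution_powerS n rho mu :
    free_convolution_power nu n rho ->
    free_additive_convolution rho nu mu ->
    free_convolution_power nu n.+1 mu.

Definition freely_infinitely_divisible mu : Prop :=
  forall n, (1 <= n)%N ->
    exists nu : probability (measurableTypeR R) R, free_convolution_power nu n mu.

End free_convolution.

Section beta_distribution.
Variable R : realType.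
Local Notation leb := (@lebesgue_measure R).

Definition beta_kernel (p q x : R) : R := x `^ (p - 1) * (1 - x) `^ (q - 1).

Definition euler_beta (p q : R) : R :=
  \int[leb]_(x in `]0, 1[) beta_kernel p q x.

Definition beta_density (p q x : R) : R :=
  if x \in `]0, 1[%R then beta_kernel p q x / euler_beta p q else 0.

Lemma beta_kernel_ge0 p q x : 0 <= beta_kernel p q x.
Proof. by rewrite mulr_ge0 // powR_ge0. Qed.

Lemma measurable_beta_kernel p q :
  measurable_fun [set: measurableTypeR R] (beta_kernel p q).
Proof.
apply: measurable_funM; first exact: measurable_powR.
apply: (measurableT_comp (measurable_powR _)) => //.
exact: measurable_funB.
Qed.

Lemma integral_FTC_cutoff (f F : R -> R) (a b : nat -> R) (M : R) :
  (forall x, 0 <= f x) ->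
  measurable_fun [set: measurableTypeR R] f ->
  (forall n, a n < b n) ->
  (forall m n, (m <= n)%N -> `[a m, b m]%classic `<=` `[a n, b n]%classic) ->
  `]0, 1[%classic `<=` \bigcup_n `[a n, b n]%classic ->
  (forall n x, a n <= x <= b n -> is_derive x 1 F (f x)) ->
  (forall n x, a n <= x <= b n -> {for x, continuous f}) ->
  (forall n, F (b n) - F (a n) <= M) ->
  (\int[leb]_(x in `]0%R, 1%R[) (f x)%:E < +oo)%E.
Proof.
move=> f0 mf ab nd cov dF cf FM.
have mf' : measurable_fun [set: measurableTypeR R] (EFin \o f) by exact/measurable_EFinP.
have step n : (\int[leb]_(x in `[a n, b n]) (f x)%:E <= M%:E)%E.
  rewrite (@continuous_FTC2 _ f F) //.
  - by rewrite -EFinB lee_fin.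
  - apply: continuous_in_subspaceT => x; rewrite inE /= in_itv /=; exact: cf.
  - have dc x : a n <= x <= b n -> {for x, continuous F}.
      move=> /dF dx; apply/differentiable_continuous/derivable1_diffP.
      exact: ex_derive.
    split.
    + move=> x; rewrite in_itv /= => /andP[/ltW ax /ltW xb].
      by apply: (@ex_derive _ _ _ _ _ _ _ (dF n x _)); rewrite ax xb.
    + by apply: cvg_at_right_filter; apply: dc; rewrite lexx ltW.
    + by apply: cvg_at_left_filter; apply: dc; rewrite lexx ltW.
  - move=> x; rewrite in_itv /= => /andP[/ltW ax /ltW xb].
    rewrite derive1E; apply: (@derive_val _ _ _ _ _ _ _ (dF n x _)).
    by rewrite ax xb.
apply: (@le_lt_trans _ _ (\int[leb]_(x in \bigcup_n `[a n, b n]%classic) (f x)%:E)%E).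
  apply: ge0_subset_integral => //.
  - exact: bigcupT_measurable.
  - exact: measurable_funTS.
  - by move=> x _; rewrite lee_fin.
apply: (@le_lt_trans _ _ M%:E); last exact: ltry.
have cv := @ge0_nondecreasing_set_cvg_integral _ _ _
   (fun n => `[a n, b n]%classic : set (measurableTypeR R)) (EFin \o f) leb.
have {}cv := cv (fun m n mn => introT (subsetPset _ _) (nd m n mn)).
have {}cv := cv (fun n => measurable_itv _) (fun n => measurable_funTS mf').
have {}cv := cv (fun n x xn => f0 x).
rewrite -(cvg_lim _ cv) //; apply: lime_le; first by apply/cvg_ex; eexists; exact: cv.
by apply: nearW => n; exact: step.
Qed.

Lemma integral_powR_lty (p : R) : 0 < p ->
  (\int[leb]_(x in `]0%R, 1%R[) (x `^ (p - 1))%:E < +oo)%E.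
Proof.
move=> p0.
have a0 n : 0 < n.+2%:R^-1 :> R by rewrite invr_gt0.
apply: (@integral_FTC_cutoff _ (fun x => p^-1 * x `^ p)
  (fun n => n.+2%:R^-1) (fun=> 1) (p^-1)).
- by move=> x; exact: powR_ge0.
- exact: measurable_powR.
- by move=> n; rewrite invf_lt1 ?ltr1n.
- move=> m n mn x /=; rewrite !in_itv /= => /andP[mx ->]; rewrite andbT.
  by apply: le_trans mx; rewrite lef_pV2 ?posrE // ler_nat !ltnS.
- move=> x /=; rewrite in_itv /= => /andP[x0 x1].
  exists (Num.trunc x^-1) => //=; rewrite in_itv /= (ltW x1) andbT.
  rewrite invf_ple ?posrE // (le_trans (ltW (truncnS_gt _))) // ler_nat.
  exact: leqnSn.
- move=> n x /andP[ax xb]; have x0 : 0 < x by apply: lt_le_trans ax.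
  have := is_derive1_powR p x0 => dp.
  apply: (is_derive_eq (is_deriveZ _ _)) => //.
  by rewrite /GRing.scale /= mulKf // gt_eqF.
- move=> n x /andP[ax xb]; have x0 : 0 < x by apply: lt_le_trans ax.
  apply/differentiable_continuous/derivable1_diffP.
  exact: (@ex_derive _ _ _ _ _ _ _ (is_derive1_powR _ x0)).
- move=> n; rewrite powR1 mulr1 gerBl mulr_ge0 ?powR_ge0 //.
  by rewrite invr_ge0 ltW.
Qed.

Lemma integral_onem_powR_lty (p : R) : 0 < p ->
  (\int[leb]_(x in `]0%R, 1%R[) ((1 - x) `^ (p - 1))%:E < +oo)%E.
Proof.
move=> p0.
have a0 n : 0 < n.+2%:R^-1 :> R by rewrite invr_gt0.
have pd x q : x < 1 ->
    is_derive (x : R) 1 (fun x => (1 - x) `^ q) (- (q * (1 - x) `^ (q - 1))).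
  move=> x1; have x0 : 0 < 1 - x by rewrite subr_gt0.
  have dp := is_derive1_powR q x0.
  have d1 : is_derive (x : R) (1 : R) (fun y : R => 1 - y) (0 - 1).
    exact: (is_deriveB (is_derive_cst (1 : R) x 1) (is_derive_id x 1)).
  have := @is_derive1_comp _ (@powR R ^~ q) (fun y : R => 1 - y) x _ _ dp d1.
  by move=> dd; apply: (is_derive_eq dd); rewrite sub0r mulrN1.
have x1 n x : 0 <= x <= 1 - n.+2%:R^-1 -> x < 1.
  by move=> /andP[_ /le_lt_trans]; apply; rewrite gtrBl.
apply: (@integral_FTC_cutoff _ (fun x => (- p^-1) * (1 - x) `^ p)
  (fun=> 0) (fun n => 1 - n.+2%:R^-1) (p^-1)).
- by move=> x; exact: powR_ge0.
- apply: (measurableT_comp (measurable_powR _)) => //; exact: measurable_funB.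
- by move=> n; rewrite subr_gt0 invf_lt1 ?ltr1n.
- move=> m n mn x /=; rewrite !in_itv /= => /andP[-> mx] /=.
  by apply: le_trans mx _; rewrite lerB // lef_pV2 ?posrE // ler_nat !ltnS.
- move=> x /=; rewrite in_itv /= => /andP[x0 x1'].
  exists (Num.trunc (1 - x)^-1) => //=; rewrite in_itv /= (ltW x0) /=.
  rewrite lerBrDr addrC -lerBrDr.
  rewrite invf_ple ?posrE ?subr_gt0 // (le_trans (ltW (truncnS_gt _))) // ler_nat.
  exact: leqnSn.
- move=> n x /x1 {}x1; have dp := pd x p x1.
  apply: (is_derive_eq (is_deriveZ _ _)) => //.
  by rewrite /GRing.scale /= mulrNN mulKf // gt_eqF.
- move=> n x /x1 {}x1.
  apply/differentiable_continuous/derivable1_diffP.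
  exact: (@ex_derive _ _ _ _ _ _ _ (pd x (p - 1) x1)).
- move=> n; rewrite subr0 powR1 mulr1 opprK mulNr gerDr oppr_le0.
  by rewrite mulr_ge0 ?powR_ge0 // invr_ge0 ltW.
Qed.

Lemma powR_half_bound (r a : R) : 2^-1 <= r <= 1 -> r `^ a <= 1 + 2^-1 `^ a.
Proof.
move=> /andP[r2 r1]; have r0 : 0 < r by apply: lt_le_trans r2; rewrite invr_gt0.
have [a0|a0] := leP 0 a.
  apply: (@le_trans _ _ 1); last by rewrite lerDl powR_ge0.
  have := @ge0_ler_powR _ a a0 r 1; rewrite powR1; apply => //.
  by rewrite nnegrE ltW.
  by rewrite nnegrE.
apply: (@le_trans _ _ (2^-1 `^ a)); last by rewrite lerDr.
rewrite -(opprK a) !(powRN _ (- a)) lef_pV2 ?posrE ?powR_gt0 ?invr_gt0 //.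
by apply: ge0_ler_powR => //; rewrite ?nnegrE ?oppr_ge0 ?ltW ?invr_gt0.
Qed.

Lemma integral_beta_kernel_lty (p q : R) : 0 < p -> 0 < q ->
  (\int[leb]_(x in `]0%R, 1%R[) (beta_kernel p q x)%:E < +oo)%E.
Proof.
move=> p0 q0.
pose cp := 1 + 2^-1 `^ (p - 1) : R; pose cq := 1 + 2^-1 `^ (q - 1) : R.
have cp0 : 0 <= cp by rewrite addr_ge0 ?powR_ge0.
have cq0 : 0 <= cq by rewrite addr_ge0 ?powR_ge0.
have m1 : measurable_fun [set: measurableTypeR R] (fun x : R => (x `^ (p - 1))%:E).
  by apply/measurable_EFinP; exact: measurable_powR.
have m2 : measurable_fun [set: measurableTypeR R] (fun x : R => ((1 - x) `^ (q - 1))%:E).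
  apply/measurable_EFinP/(measurableT_comp (measurable_powR _)) => //.
  exact: measurable_funB.
apply: (@le_lt_trans _ _ (\int[leb]_(x in `]0%R, 1%R[)
  (cq%:E * (x `^ (p - 1))%:E + cp%:E * ((1 - x) `^ (q - 1))%:E))%E).
  apply: ge0_le_integral => //.
  - by move=> x _; rewrite lee_fin beta_kernel_ge0.
  - apply: measurable_funTS; apply/measurable_EFinP; exact: measurable_beta_kernel.
  - by apply: emeasurable_funD; apply: emeasurable_funM => //; exact: measurable_funTS.
  move=> x /=; rewrite in_itv /= => /andP[x0 x1].
  rewrite -!EFinM -EFinD lee_fin /beta_kernel.
  have [xh|xh] := leP x 2^-1.
    apply: ler_wpDr; first by rewrite mulr_ge0 ?powR_ge0.
    rewrite mulrC; apply: ler_wpM2r; first exact: powR_ge0.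
    by apply: powR_half_bound; lra.
  apply: ler_wpDl; first by rewrite mulr_ge0 ?powR_ge0.
  apply: ler_wpM2r; first exact: powR_ge0.
  by apply: powR_half_bound; lra.
rewrite ge0_integralD //=; last 4 first.
- by move=> x _; rewrite mule_ge0 // lee_fin ?powR_ge0.
- by apply: emeasurable_funM => //; exact: measurable_funTS.
- by move=> x _; rewrite mule_ge0 // lee_fin ?powR_ge0.
- by apply: emeasurable_funM => //; exact: measurable_funTS.
rewrite !ge0_integralZl //=; try (exact: measurable_funTS);
  try (by move=> x _; rewrite lee_fin powR_ge0).
by rewrite lte_add_pinfty // lte_mul_pinfty // ?lee_fin //
  ?integral_powR_lty ?integral_onem_powR_lty.
Qed.

Lemma EFin_euler_beta (p q : R) : 0 < p -> 0 < q ->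
  (euler_beta p q)%:E = (\int[leb]_(x in `]0%R, 1%R[) (beta_kernel p q x)%:E)%E.
Proof.
move=> p0 q0; rewrite /euler_beta /Rintegral fineK // ge0_fin_numE.
  exact: integral_beta_kernel_lty.
by apply: integral_ge0 => x _; rewrite lee_fin beta_kernel_ge0.
Qed.

Lemma euler_beta_gt0 (p q : R) : 0 < p -> 0 < q -> 0 < euler_beta p q.
Proof.
move=> p0 q0; rewrite lt_neqAle; apply/andP; split; last first.
  by rewrite -lee_fin EFin_euler_beta // integral_ge0 // => x _;
    rewrite lee_fin beta_kernel_ge0.
apply/eqP => B0; have := EFin_euler_beta p0 q0; rewrite -B0 => /esym I0.
have mk : measurable_fun (`]0%R, 1%R[%classic : set (measurableTypeR R)) (EFin \o beta_kernel p q).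
  by apply: measurable_funTS; apply/measurable_EFinP; exact: measurable_beta_kernel.
have /(ae_eq_integral_abs leb (measurable_itv _) mk) [N [mN N0 sN]] :
    (\int[leb]_(x in `]0%R, 1%R[) `|(EFin \o beta_kernel p q) x| = 0)%E.
  apply: etrans I0; apply: eq_integral => x _ /=.
  by rewrite ger0_norm // beta_kernel_ge0.
have : (leb `]0%R, 1%R[%classic <= leb N)%E.
  apply: le_measure; rewrite ?inE //.
  move=> x x01; apply: sN => /= /(_ x01) /= [] /eqP.
  move: x01; rewrite /= in_itv /= => /andP[x0 x1].
  by apply/negP; rewrite gt_eqF // mulr_gt0 // powR_gt0 // subr_gt0.
by rewrite N0 lebesgue_measure_itv /= lte_fin ltr01 -EFinD lee_fin subr0 ler10.
Qed.

Variables p q : {posnum R}.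

Lemma beta_density_ge0 x : 0 <= beta_density p%:num q%:num x.
Proof.
rewrite /beta_density; case: ifP => // _.
by rewrite divr_ge0 ?beta_kernel_ge0 // ltW // euler_beta_gt0.
Qed.

Lemma measurable_beta_density :
  measurable_fun [set: measurableTypeR R] (beta_density p%:num q%:num).
Proof.
apply: measurable_fun_ifT => //.
  apply: (measurable_fun_bool true) => //.
  rewrite setTI; exact: (measurable_itv `]0%R, 1%R[).
by apply: measurable_funM => //; exact: measurable_beta_kernel.
Qed.

Definition beta_distribution (A : set (measurableTypeR R)) : \bar R :=
  (\int[leb]_(x in A) (beta_density p%:num q%:num x)%:E)%E.

Let beta_distribution0 : beta_distribution set0 = 0%:E.
Proof. by rewrite /beta_distribution integral_set0. Qed.

Let beta_distribution_ge0 A : (0 <= beta_distribution A)%E.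
Proof. by apply: integral_ge0 => x _; rewrite lee_fin beta_density_ge0. Qed.

Let beta_distribution_sigma_additive : semi_sigma_additive beta_distribution.
Proof.
move=> /= F mF tF mUF; rewrite /beta_distribution; apply: cvg_toP.
  apply: ereal_nondecreasing_is_cvgn => m n mn.
  by apply: lee_sum_nneg_natr => // k _ _; exact: beta_distribution_ge0.
rewrite ge0_integral_bigcup //=.
- by apply/measurable_funTS/measurable_EFinP; exact: measurable_beta_density.
- by move=> x _; rewrite lee_fin beta_density_ge0.
Qed.

HB.instance Definition _ := isMeasure.Build _ _ _ beta_distribution
  beta_distribution0 beta_distribution_ge0 beta_distribution_sigma_additive.

Let beta_distribution_setT : beta_distribution setT = 1%:E.
Proof.
have B0 : 0 < euler_beta p%:num q%:num by exact: euler_beta_gt0.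
rewrite /beta_distribution.
transitivity (\int[leb]_(x in `]0%R, 1%R[)
    ((euler_beta p%:num q%:num)^-1%:E * (beta_kernel p%:num q%:num x)%:E))%E.
  rewrite [RHS]integral_mkcond; apply: eq_integral => x _.
  rewrite patchE /beta_density mem_setE; case: ifP => // _.
  by rewrite -EFinM mulrC.
rewrite ge0_integralZl //=.
- by rewrite -EFin_euler_beta // -EFinM mulVf ?gt_eqF.
- by apply/measurable_funTS/measurable_EFinP; exact: measurable_beta_kernel.
- by move=> x _; rewrite lee_fin beta_kernel_ge0.
- by rewrite lee_fin invr_ge0 ltW.
Qed.

HB.instance Definition _ := @Measure_isProbability.Build _ _ _
  beta_distribution beta_distribution_setT.

End beta_distribution.

Section regions.
Variable R : realType.

Definition Psi (p q : R) : R :=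
  let s := p + q in
  2 * s ^+ 3 * (s + 1) + p * q * (s ^+ 3 - 7 * s ^+ 2 - 16 * s - 12).

Definition I_set : set R :=
  (\bigcup_(n in [set n | (1 <= n)%N])
     `](2 * n%:R - 1) / (2 * n%:R), (2 * n%:R) / (2 * n%:R + 1)[%classic) `|`
  (\bigcup_(n in [set n | (1 <= n)%N])
     `](2 * n%:R + 2) / (2 * n%:R + 1), (2 * n%:R + 1) / (2 * n%:R)[%classic).

End regions.

(* Main.v *)
Require Import Defs.
From mathcomp Require Import all_boot all_order all_algebra.
From mathcomp Require Import complex.
From mathcomp Require Import all_classical all_reals all_analysis.
From mathcomp Require Import measurable_realfun ring lra.

Set Implicit Arguments.
Unset Strict Implicit.
Unset Printing Implicit Defensive.

Import Order.TTheory GRing.Theory Num.Theory.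
Import numFieldNormedType.Exports.
Import ComplexField.Normc.

Local Open Scope classical_set_scope.
Local Open Scope ring_scope.
Local Open Scope complex_scope.

(** A Voiculescu transform [phi] of a probability measure [mu] is used only on the
    imaginary axis, where it is unique near infinity; hence
    [phi_mu (iy) = n * phi_nu (iy)] for large [y] whenever [mu] is the [n]-th free
    power of [nu].  Nothing is known about the moments of [nu], but with
    [z_j = i / (j e)] (j = 1, 2), [r = 1/n] and [w_j = z_j + r phi_mu z_j] one has
    [G_nu w_j = 1 / z_j], so the resolvent identity gives the Gram matrix in
    [L^2 nu] of the functions [x |-> z_j / (w_j - x) - 1] as
    [(1 - r K_jk)^-1 - 1], where
    [K_jk = (phi_mu z_j - conj (phi_mu z_k)) / (conj z_k - z_j)]
    involves [mu] only.  When [mu] has bounded support,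
    [phi_mu z = m + k2 / z + k3 / z^2 + k4 / z^3 + O(z^-4)] with [k_j] the free
    cumulants, and testing the Gram matrix against suitable coefficients gives, at
    order [e^4], [k2 a^2 + 2 k3 a b + (k4 + r k2^2) b^2 >= 0] for all real [a, b].
    For the beta distribution of the theorem this already fails for [n = 10]. *)

(** * Complex-valued expectations *)

Section complex_modulus.
Variable R : realType.
Implicit Types z w : R[i].

(** If [nu] had a fourth moment, its central moments would be [r k2], [r k3] and
    [r k4 + 2 r^2 k2^2]. The variance of [a x + b x^2], with [x] counted from the mean of [nu],
    would then be [r] times the quadratic form, which explains both the inequality and the
    correction [r k2^2]. Bounded resolvents stand in for [x] and [x^2], whatever the tails of [nu].
    As [n] grows the form tends to the Hankel form of [k2, k3, k4], so that free infinite
    divisibility forces [k2 k4 - k3^2 >= 0]. For the beta distribution with [s = p + q] this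
    determinant is [p^2 q^2 Psi(p, q) / (s^6 (s + 1)^3 (s + 2)^2 (s + 3))], which is where [Psi]
    comes from. Keeping [r = 1/n] fixed avoids a limit in [n]: at the point of the theorem the
    determinant with [k4 + r k2^2] is negative as soon as [n >= 7], and 10 leaves a margin. The
    cumulants are evaluated at that single point; [Psi] itself is only bounded on a box around
    it. *)

Lemma normc_ge0 z : 0 <= normc z.
Proof. by case: z => a b; exact: sqrtr_ge0. Qed.

Lemma normcX z n : normc (z ^+ n) = normc z ^+ n.
Proof. by elim: n => [|n IH]; rewrite ?expr0 ?normc1// !exprS normcM IH. Qed.

Lemma normc_real (r : R) : normc r%:C = `|r|.
Proof. by rewrite /= expr0n /= addr0 sqrtr_sqr. Qed.

Lemma normc_conj z : normc (conjc z) = normc z.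
Proof. by case: z => a b /=; rewrite sqrrN. Qed.

Lemma normr_Re_le z : `|complex.Re z| <= normc z.
Proof. by have := normc_ge_Re z; rewrite lecR. Qed.

Lemma normr_Im_le z : `|complex.Im z| <= normc z.
Proof.
case: z => a b /=; rewrite -sqrtr_sqr ler_sqrt ?addr_ge0 ?sqr_ge0//.
by rewrite lerDr sqr_ge0.
Qed.

Lemma normc_le_ReIm z : normc z <= `|complex.Re z| + `|complex.Im z|.
Proof.
rewrite {1}(complexE z); apply: le_trans (le_normcD _ _) _.
by rewrite normcM !normc_real /= expr0n /= add0r expr1n sqrtr1 mul1r.
Qed.

Lemma cReM z w :
  complex.Re (z * w) = complex.Re z * complex.Re w - complex.Im z * complex.Im w.
Proof. by case: z => a b; case: w. Qed.

Lemma cImM z w :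
  complex.Im (z * w) = complex.Re z * complex.Im w + complex.Im z * complex.Re w.
Proof. by case: z => a b; case: w. Qed.

Lemma cReD z w : complex.Re (z + w) = complex.Re z + complex.Re w.
Proof. by case: z => a b; case: w. Qed.

Lemma cImD z w : complex.Im (z + w) = complex.Im z + complex.Im w.
Proof. by case: z => a b; case: w. Qed.

Lemma cReN z : complex.Re (- z) = - complex.Re z.
Proof. by case: z. Qed.

Lemma cImN z : complex.Im (- z) = - complex.Im z.
Proof. by case: z. Qed.

Lemma cReJ z : complex.Re (conjc z) = complex.Re z.
Proof. by case: z. Qed.

Lemma cImJ z : complex.Im (conjc z) = - complex.Im z.
Proof. by case: z. Qed.

Lemma cReV z : complex.Re z^-1 =
  complex.Re z / (complex.Re z ^+ 2 + complex.Im z ^+ 2).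
Proof. by case: z. Qed.

Lemma cImV z : complex.Im z^-1 =
  - (complex.Im z / (complex.Re z ^+ 2 + complex.Im z ^+ 2)).
Proof. by case: z. Qed.

Lemma conjcD z w : conjc (z + w) = conjc z + conjc w.
Proof. by case: z => a b; case: w => c d /=; rewrite opprD. Qed.

Lemma conjcN z : conjc (- z) = - conjc z.
Proof. by case: z. Qed.

Lemma conjcM z w : conjc (z * w) = conjc z * conjc w.
Proof. exact: (rmorphM (@conjc R)). Qed.

Lemma conjcX z n : conjc (z ^+ n) = conjc z ^+ n.
Proof. exact: (rmorphXn (@conjc R)). Qed.

Lemma conjci : conjc ('i : R[i]) = - 'i.
Proof. by apply/eqP; rewrite eq_complex /= oppr0 !eqxx. Qed.

End complex_modulus.

Section complex_expectation.
Variables (R : realType) (P : probability (measurableTypeR R) R).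
Variable D : set (measurableTypeR R).
Hypotheses (mD : measurable D) (PD : P D = 1%E).
Implicit Types (f g : R -> R[i]) (h : R -> R).

Definition complex_expectation f : R[i] :=
  (\int[P]_x complex.Re (f x)) +i* (\int[P]_x complex.Im (f x)).
Local Notation "''E' f" := (complex_expectation f) (at level 10).

(** The bound is asked on [D] only, a set of full measure, so that one notion covers resolvents,
    bounded everywhere, and powers of [x], bounded on the support. *)
Definition bounded_measurable f :=
  [/\ measurable_fun [set: measurableTypeR R] (@complex.Re R \o f : measurableTypeR R -> R),
      measurable_fun [set: measurableTypeR R] (@complex.Im R \o f : measurableTypeR R -> R) &
      exists M, forall x, D x -> normc (f x) <= M].

Let PDC : P (~` D) = 0%E.
Proof. by rewrite probability_setC// PD subee. Qed.

Lemma integrable_of_bounded h (M : R) :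
  measurable_fun [set: measurableTypeR R] h -> (forall x, D x -> `|h x| <= M) ->
  P.-integrable setT (EFin \o h).
Proof.
move=> mh hM; rewrite (negligible_integrable (measurableC mD)) //; last first.
  exact/measurable_EFinP.
rewrite setDE setCK setTI.
apply: measurable_bounded_integrable => //.
- exact: (le_lt_trans (probability_le1 P mD) (ltry _)).
- exact: measurable_funTS.
- exists M; split; first exact: num_real.
  by move=> r Mr x /= Dx; exact: le_trans (hM x Dx) (ltW Mr).
Qed.

Lemma Rintegral_restrict h (M : R) :
  measurable_fun [set: measurableTypeR R] h -> (forall x, D x -> `|h x| <= M) ->
  \int[P]_x h x = \int[P]_(x in D) h x.
Proof.
move=> mh hM; rewrite /Rintegral (negligible_integral (measurableC mD))//.
  by rewrite setDE setCK setTI.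
exact: integrable_of_bounded mh hM.
Qed.

Lemma bounded_measurable_integrable f : bounded_measurable f ->
  P.-integrable setT (EFin \o (@complex.Re R \o f)) /\
  P.-integrable setT (EFin \o (@complex.Im R \o f)).
Proof.
move=> [m1 m2 [M fM]]; split; apply: (@integrable_of_bounded _ M) => // x /fM;
  apply: le_trans; [exact: normr_Re_le|exact: normr_Im_le].
Qed.

Lemma bounded_measurableD f g : bounded_measurable f -> bounded_measurable g ->
  bounded_measurable (fun x => f x + g x).
Proof.
move=> [f1 f2 [M fM]] [g1 g2 [N gN]]; split.
- rewrite (_ : _ \o _ = fun x => complex.Re (f x) + complex.Re (g x)); last first.
    by apply/funext => x /=; rewrite cReD.
  exact: measurable_funD.
- rewrite (_ : _ \o _ = fun x => complex.Im (f x) + complex.Im (g x)); last first.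
    by apply/funext => x /=; rewrite cImD.
  exact: measurable_funD.
- exists (M + N) => x Dx; apply: le_trans (le_normcD _ _) _.
  by apply: lerD; [exact: fM|exact: gN].
Qed.

Lemma bounded_measurableM f g : bounded_measurable f -> bounded_measurable g ->
  bounded_measurable (fun x => f x * g x).
Proof.
move=> [f1 f2 [M fM]] [g1 g2 [N gN]]; split.
- rewrite (_ : _ \o _ = fun x => complex.Re (f x) * complex.Re (g x) -
      complex.Im (f x) * complex.Im (g x)); last first.
    by apply/funext => x /=; rewrite cReM.
  by apply: measurable_funB; exact: measurable_funM.
- rewrite (_ : _ \o _ = fun x => complex.Re (f x) * complex.Im (g x) +
      complex.Im (f x) * complex.Re (g x)); last first.
    by apply/funext => x /=; rewrite cImM.
  by apply: measurable_funD; exact: measurable_funM.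
- exists (M * N) => x Dx; rewrite normcM.
  by apply: ler_pM; rewrite ?normc_ge0//; [exact: fM|exact: gN].
Qed.

Lemma bounded_measurable_cst z : bounded_measurable (fun=> z).
Proof.
split; [exact: measurable_cst|exact: measurable_cst|].
by exists (normc z).
Qed.

Lemma bounded_measurableJ f : bounded_measurable f ->
  bounded_measurable (fun x => conjc (f x)).
Proof.
move=> [f1 f2 [M fM]]; split.
- rewrite (_ : _ \o _ = @complex.Re R \o f)//.
  by apply/funext => x /=; rewrite cReJ.
- rewrite (_ : _ \o _ = fun x => - complex.Im (f x)); last first.
    by apply/funext => x /=; rewrite cImJ.
  exact: measurableT_comp.
- by exists M => x Dx; rewrite normc_conj; exact: fM.
Qed.

Lemma bounded_measurable_sum (I : Type) (s : seq I) (f : I -> R -> R[i]) :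
  (forall i, bounded_measurable (f i)) ->
  bounded_measurable (fun x => \sum_(i <- s) f i x).
Proof.
move=> bf; elim: s => [|i s IH].
  rewrite (_ : (fun _ => _) = fun=> 0); last by apply/funext => x; rewrite big_nil.
  exact: bounded_measurable_cst.
rewrite (_ : (fun _ => _) = fun x => f i x + \sum_(j <- s) f j x); last first.
  by apply/funext => x; rewrite big_cons.
exact: bounded_measurableD.
Qed.

Lemma bounded_measurableX f n : bounded_measurable f ->
  bounded_measurable (fun x => f x ^+ n).
Proof.
move=> bf; elim: n => [|n IH]; first exact: bounded_measurable_cst.
rewrite (_ : (fun _ => _) = fun x => f x * f x ^+ n).
  exact: bounded_measurableM.
by apply/funext => x; rewrite exprS.
Qed.

Lemma complex_expectationD f g : bounded_measurable f -> bounded_measurable g ->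
  'E (fun x => f x + g x) = 'E f + 'E g.
Proof.
move=> /bounded_measurable_integrable[f1 f2] /bounded_measurable_integrable[g1 g2].
rewrite /complex_expectation.
under eq_Rintegral do rewrite cReD.
under [X in _ +i* X]eq_Rintegral do rewrite cImD.
by rewrite !RintegralD.
Qed.

Let expectation_cst (r : R) : \int[P]_x r = r.
Proof.
apply: etrans (Rintegral_cst P measurableT r) _.
by apply: etrans (congr1 (fun t => r * fine t) (probability_setT P)) (mulr1 r).
Qed.

Lemma complex_expectation_cst z : 'E (fun=> z) = z.
Proof.
by rewrite /complex_expectation !expectation_cst; case: z.
Qed.

Lemma complex_expectationZ z f : bounded_measurable f ->
  'E (fun x => z * f x) = z * 'E f.
Proof.
move=> /bounded_measurable_integrable[f1 f2]; rewrite /complex_expectation.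
have i1 c : P.-integrable setT (EFin \o (fun x => c * complex.Re (f x))).
  exact: (integrableZl measurableT c f1).
have i2 c : P.-integrable setT (EFin \o (fun x => c * complex.Im (f x))).
  exact: (integrableZl measurableT c f2).
under eq_Rintegral do rewrite cReM.
under [X in _ +i* X]eq_Rintegral do rewrite cImM.
rewrite RintegralB// RintegralD// !RintegralZl//.
by case: z.
Qed.

Lemma complex_expectationJ f : bounded_measurable f ->
  'E (fun x => conjc (f x)) = conjc ('E f).
Proof.
move=> /bounded_measurable_integrable[f1 f2]; rewrite /complex_expectation.
under eq_Rintegral do rewrite cReJ.
under [X in _ +i* X]eq_Rintegral do rewrite cImJ -mulN1r.
by rewrite RintegralZl// mulN1r.
Qed.

Lemma complex_expectation_sum (I : Type) (s : seq I) (f : I -> R -> R[i]) :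
  (forall i, bounded_measurable (f i)) ->
  'E (fun x => \sum_(i <- s) f i x) = \sum_(i <- s) 'E (f i).
Proof.
move=> bf; elim: s => [|i s IH].
  rewrite (_ : (fun _ => _) = fun=> 0); last by apply/funext => x; rewrite big_nil.
  by rewrite complex_expectation_cst big_nil.
rewrite (_ : (fun _ => _) = fun x => f i x + \sum_(j <- s) f j x); last first.
  by apply/funext => x; rewrite big_cons.
by rewrite complex_expectationD ?big_cons ?IH//; exact: bounded_measurable_sum.
Qed.

Lemma complex_expectation_ge0 f : bounded_measurable f ->
  (forall x, D x -> 0 <= complex.Re (f x)) -> 0 <= complex.Re ('E f).
Proof.
move=> [m1 m2 [M fM]] f0; rewrite /complex_expectation /=.
rewrite (@Rintegral_restrict (@complex.Re R \o f) M)//.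
  by apply: Rintegral_ge0 => x; exact: f0.
by move=> x /fM; apply: le_trans; exact: normr_Re_le.
Qed.

(** Real and imaginary parts are bounded separately, whence the factor 2; only the order of
    magnitude matters later. *)
Lemma complex_expectation_bound f (M : R) : bounded_measurable f ->
  (forall x, D x -> normc (f x) <= M) -> normc ('E f) <= 2 * M.
Proof.
move=> bf fM; have [m1 m2 _] := bf.
have bound h : measurable_fun [set: measurableTypeR R] h ->
    (forall x, D x -> `|h x| <= M) -> `|\int[P]_x h x| <= M.
  move=> mh hM; rewrite (Rintegral_restrict mh hM).
  have ih := integrable_of_bounded mh hM.
  have ihD : P.-integrable D (EFin \o h) by exact: integrableS ih.
  apply: le_trans (le_normr_Rintegral mD ihD) _.
  have <- : \int[P]_(x in D) M = M.
    apply: etrans (Rintegral_cst P mD M) _.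
    by apply: etrans (congr1 (fun t => M * fine t) PD) (mulr1 M).
  apply: le_Rintegral => //; first exact: integrable_norm.
  apply: measurable_bounded_integrable => //.
    exact: (le_lt_trans (probability_le1 P mD) (ltry _)).
  exact: bounded_cst.
apply: le_trans (normc_le_ReIm _) _.
rewrite mulrDl mul1r /=; apply: lerD; apply: bound => // x /fM; apply: le_trans.
  exact: normr_Re_le.
exact: normr_Im_le.
Qed.

Lemma bounded_measurable_real h (M : R) :
  measurable_fun [set: measurableTypeR R] h ->
  (forall x, D x -> `|h x| <= M) -> bounded_measurable (fun x => (h x)%:C).
Proof.
move=> mh hM; split; [exact: mh|exact: measurable_cst|exists M => x Dx].
by rewrite normc_real; exact: hM.
Qed.

Lemma complex_expectation_real h : 'E (fun x => (h x)%:C) = (\int[P]_x h x)%:C.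
Proof.
by rewrite /complex_expectation /= expectation_cst.
Qed.

End complex_expectation.

(** * Uniqueness of the Voiculescu transform *)

Section resolvent.
Variable R : realType.
Implicit Types (z w : R[i]) (x : R).

Lemma resolvent_neq0 z x : 0 < complex.Im z -> z - x%:C != 0.
Proof.
by case: z => a b /= b0; rewrite eq_complex /= oppr0 addr0 negb_and (gt_eqF b0) orbT.
Qed.

Lemma normc_resolvent_le z x : 0 < complex.Im z ->
  normc (z - x%:C)^-1 <= (complex.Im z)^-1.
Proof.
move=> z0; rewrite normcV.
have h : complex.Im z <= normc (z - x%:C).
  apply: le_trans (normr_Im_le _); apply: le_trans (ler_norm _) _.
  by case: z {z0} => a b /=; rewrite oppr0 addr0.
by rewrite lef_pV2 ?posrE//; exact: lt_le_trans h.
Qed.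

Lemma bounded_measurable_resolvent D z : 0 < complex.Im z ->
  bounded_measurable D (fun x : R => (z - x%:C)^-1).
Proof.
move=> z0; have zx x : complex.Re (z - x%:C) = complex.Re z - x.
  by rewrite cReD cReN.
have zy x : complex.Im (z - x%:C) = complex.Im z.
  by rewrite cImD cImN oppr0 addr0.
have mden : measurable_fun [set: measurableTypeR R]
    (fun x : R => ((complex.Re z - x) ^+ 2 + complex.Im z ^+ 2)^-1).
  apply: continuous_measurable_fun => x.
  apply: cvgV.
    by rewrite gt_eqF// ltr_wpDl ?sqr_ge0// exprn_gt0.
  apply: cvgD; last exact: cvg_cst.
  rewrite [X in _ --> X]expr2.
  rewrite (_ : (fun _ : R => _) = fun y : R => (complex.Re z - y) * (complex.Re z - y)).
    apply: cvgM; (apply: cvgB; [exact: cvg_cst|exact: cvg_id]).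
  by apply/funext => y; rewrite expr2.
split.
- rewrite (_ : _ \o _ = fun x : R => (complex.Re z - x) *
      ((complex.Re z - x) ^+ 2 + complex.Im z ^+ 2)^-1); last first.
    by apply/funext => x /=; rewrite cReV zx zy.
  apply: measurable_funM => //; exact: measurable_funB.
- rewrite (_ : _ \o _ = fun x : R => - complex.Im z *
      ((complex.Re z - x) ^+ 2 + complex.Im z ^+ 2)^-1); last first.
    by apply/funext => x /=; rewrite cImV zx zy mulNr.
  exact: measurable_funM.
- by exists (complex.Im z)^-1 => x _; exact: normc_resolvent_le.
Qed.

Lemma cauchy_transformE (P : probability (measurableTypeR R) R) z :
  cauchy_transform P z = complex_expectation P (fun x => (z - x%:C)^-1).
Proof. by []. Qed.

End resolvent.

Section uniqueness.
Variable R : realType.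
Implicit Types (mu nu : probability (measurableTypeR R) R) (phi : R -> R[i]).

Lemma tail_probability mu : exists M : R, 0 < M /\ (mu (~` `[(- M)%R, M]%classic) <= (1/10)%:E)%E.
Proof.
pose F (n : nat) : set (measurableTypeR R) := `[- n%:R, n%:R]%classic.
have mF n : measurable (F n) by exact: measurable_itv.
have cF : \bigcup_n F n = setT.
  apply/seteqP; split => // x _; exists (Num.trunc `|x|).+1 => //=.
  by rewrite /F /= in_itv /= -ler_norml; exact/ltW/truncnS_gt.
have cv : mu (F n) @[n --> \oo] --> mu (\bigcup_n F n).
  apply: nondecreasing_cvg_mu => //; first exact: bigcup_measurable.
  move=> m n mn; apply/subsetPset => x; rewrite /F /= !in_itv /= -!ler_norml.
  by move=> /le_trans; apply; rewrite ler_nat.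
have [n nF] : exists n, (mu (F n) > (9/10)%:E)%E.
  apply: contrapT => /forallNP nn.
  have : (mu (\bigcup_n F n) <= (9/10)%:E)%E.
    rewrite -(cvg_lim _ cv)//; apply: lime_le; first by apply/cvg_ex; eexists; exact: cv.
    by apply: nearW => n; rewrite leNgt; apply/negP; exact: nn.
  rewrite cF; move=> /(le_trans (eq_ind_r (fun t => (1%E <= t)%E) (lexx _) (probability_setT mu))).
  by rewrite lee_fin; lra.
exists n.+1%:R; split => //.
rewrite probability_setC//.
apply: (@le_trans _ _ (1 - mu (F n))%E).
  apply: leeB => //; apply: le_measure; rewrite ?inE//.
  move=> x; rewrite /F /= !in_itv /= -!ler_norml.
  by move=> /le_trans; apply; rewrite ler_nat.
have := nF; have : mu (F n) \is a fin_num by exact: fin_num_measure.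
move: (mu (F n)) => [r| |]//= _; rewrite lte_fin -EFinB lee_fin => ?; lra.
Qed.

(** The trace of a Voiculescu transform on the positive imaginary axis. Every Stolz domain contains
    this axis near infinity, which makes transforms given on different domains comparable. *)
Definition axis_transform mu phi : Prop :=
  (exists Y : R, forall y, Y < y -> 0 < complex.Im (0 +i* y + phi y) /\
     cauchy_transform mu (0 +i* y + phi y) = (0 +i* y)^-1) /\
  (forall e : R, 0 < e -> exists Y : R, forall y, Y < y -> normc (phi y) <= e * y).

Lemma voiculescu_axis mu (a b : R) (phi : R[i] -> R[i]) :
  0 < a -> voiculescu_transform_on mu a b phi ->
  axis_transform mu (fun y => phi (0 +i* y)).
Proof.
move=> a0 [H1 H2]; pose Y0 := Num.max 0 b.
have st y : Y0 < y -> stolz_domain a b (0 +i* y).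
  rewrite /Y0 gt_max => /andP[y0 yb]; rewrite /stolz_domain /=; split => //.
  by rewrite normr0 mulr_gt0.
have ny y : Y0 < y -> normc (0 +i* y) = y.
  rewrite /Y0 gt_max => /andP[y0 yb].
  by rewrite /= expr0n /= add0r sqrtr_sqr gtr0_norm.
split.
  exists Y0 => y yY; have [h1 h2] := H1 _ (st y yY); split => //.
  by rewrite -[LHS]invrK; congr (_^-1); exact: h2.
move=> e /H2[r hr]; exists (Num.max Y0 r) => y; rewrite gt_max => /andP[yY yr].
have := hr _ (st _ yY); rewrite -[`|0 +i* y|]/((normc (0 +i* y))%:C) ny//.
rewrite ltcR yr => /(_ isT).
by rewrite -rmorphM lecR.
Qed.

(* With [w = a + i b] and [w' = a' + i b'], [f] is the real part of
   [- y^2 / ((w - x) (w' - x))]. *)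
Lemma resolvent_product_bounds (y a b a' b' x : R) :
  `|a| <= y / 10 -> `|a'| <= y / 10 ->
  9 / 10 * y <= b <= 11 / 10 * y -> 9 / 10 * y <= b' <= 11 / 10 * y -> 0 < y ->
  let f := y ^+ 2 * ((b * b' - (a - x) * (a' - x)) /
            (((a - x) ^+ 2 + b ^+ 2) * ((a' - x) ^+ 2 + b' ^+ 2))) in
  (`|x| <= y / 10 -> 2/5 <= f) /\ -1 <= f.
Proof.
rewrite !ler_norml => /andP[a1 a2] /andP[a3 a4] /andP[b1 b2] /andP[b3 b4] y0.
set s := a - x; set t := a' - x => /=.
have b0 : 0 < b by lra.
have b0' : 0 < b' by lra.
have p1 : 0 < s ^+ 2 + b ^+ 2 by rewrite ltr_wpDl ?sqr_ge0// exprn_gt0.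
have p2 : 0 < t ^+ 2 + b' ^+ 2 by rewrite ltr_wpDl ?sqr_ge0// exprn_gt0.
have p12 : 0 < (s ^+ 2 + b ^+ 2) * (t ^+ 2 + b' ^+ 2) by rewrite mulr_gt0.
have bb : 81 / 100 * y ^+ 2 <= b * b'.
  have -> : 81 / 100 * y ^+ 2 = (9 / 10 * y) * (9 / 10 * y) by field.
  by apply: ler_pM => //; lra.
rewrite mulrA; split.
- move=> /andP[x1 x2].
  have sq (r c : R) : - c <= r -> r <= c -> r ^+ 2 <= c ^+ 2.
    move=> h1 h2; have : 0 <= (c - r) * (c + r) by apply: mulr_ge0; lra.
    by lra.
  have s2 : s ^+ 2 <= (y / 5) ^+ 2 by apply: sq; rewrite /s; lra.
  have t2 : t ^+ 2 <= (y / 5) ^+ 2 by apply: sq; rewrite /t; lra.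
  have b2' : b ^+ 2 <= (11 / 10 * y) ^+ 2 by apply: sq; lra.
  have b4' : b' ^+ 2 <= (11 / 10 * y) ^+ 2 by apply: sq; lra.
  rewrite ler_pdivlMr//.
  (* With [|s|, |t| <= y/5] the quotient is at least [(81/100 - 1/25) / (121/100 + 1/25)^2], which
     exceeds 2/5. *)
  have h1 : (s ^+ 2 + b ^+ 2) * (t ^+ 2 + b' ^+ 2) <=
      (5 / 4 * y ^+ 2) * (5 / 4 * y ^+ 2).
    by apply: ler_pM; nra.
  have h2 : 77 / 100 * y ^+ 2 <= b * b' - s * t by nra.
  have h3 : y ^+ 2 * (77 / 100 * y ^+ 2) <= y ^+ 2 * (b * b' - s * t).
    by rewrite ler_pM2l// exprn_gt0.
  have y4 : 0 < y ^+ 2 * y ^+ 2 by rewrite mulr_gt0// exprn_gt0.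
  nra.
- rewrite ler_pdivlMr// mulN1r.
  (* By the arithmetic-geometric inequality the denominator is at least [4 |s t| b b'], hence at
     least [3 y^2 |s t|]; so even distant [x] contribute no less than -1. *)
  have sb : 2 * (`|s| * b) <= s ^+ 2 + b ^+ 2.
    have := sqr_ge0 (`|s| - b); rewrite sqrrB real_normK ?num_real//; lra.
  have tb : 2 * (`|t| * b') <= t ^+ 2 + b' ^+ 2.
    have := sqr_ge0 (`|t| - b'); rewrite sqrrB real_normK ?num_real//; lra.
  have h1 : (2 * (`|s| * b)) * (2 * (`|t| * b')) <=
     (s ^+ 2 + b ^+ 2) * (t ^+ 2 + b' ^+ 2).
    by apply: ler_pM => //; rewrite !mulr_ge0// ltW.
  have h2 : s * t <= `|s| * `|t| by rewrite -normrM ler_norm.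
  have st0 : 0 <= `|s| * `|t| by rewrite mulr_ge0.
  have y2 : 0 < y ^+ 2 by rewrite exprn_gt0.
  have h3 : y ^+ 2 * (s * t) <= y ^+ 2 * (`|s| * `|t|) by rewrite ler_pM2l.
  have h4 : (81 / 100 * y ^+ 2) * (`|s| * `|t|) <= (b * b') * (`|s| * `|t|).
    by rewrite ler_wpM2r.
  have h5 : 0 <= y ^+ 2 * (`|s| * `|t|) by rewrite mulr_ge0// ltW.
  have h6 : 0 <= y ^+ 2 * (b * b') by rewrite !mulr_ge0// ltW.
  nra.
Qed.

(* If [w <> w'] and [G w = G w'] then [1 / ((w - x) (w' - x))] has integral [0], but
   [- y^2] times this function has positive real part except on an event of small
   probability. *)
Lemma axis_transform_unique mu nu phi phi' :
  (forall z, 0 < complex.Im z -> cauchy_transform mu z = cauchy_transform nu z) ->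
  axis_transform mu phi -> axis_transform nu phi' ->
  exists Y : R, forall y, Y < y -> phi y = phi' y.
Proof.
move=> mn [[Y1 H1] A1] [[Y2 H2] A2].
have [Y3 {}A1] := A1 (1/10) ltac:(lra).
have [Y4 {}A2] := A2 (1/10) ltac:(lra).
have [M [M0 tM]] := tail_probability nu.
exists (Num.max (Num.max Y1 Y2) (Num.max (Num.max Y3 Y4) (10 * M))) => y.
rewrite !gt_max => /andP[/andP[y1 y2] /andP[/andP[y3 y4] yM]].
have y0 : 0 < y by lra.
have [w0 Gw] := H1 _ y1; have [w0' Gw'] := H2 _ y2.
have := A1 _ y3; have := A2 _ y4.
rewrite mn// in Gw.
case e1 : (phi y) => [c d]; case e2 : (phi' y) => [c' d'] n2 n1.
rewrite e1 in Gw w0; rewrite e2 in Gw' w0'.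
apply: contrapT => /eqP ne.
set w := 0 +i* y + c +i* d in Gw w0; set w' := 0 +i* y + c' +i* d' in Gw' w0'.
have ww' : w' - w != 0.
  rewrite /w /w' opprD addrACA subrr add0r subr_eq0 eq_sym.
  exact: ne.
have bd z : normc z <= 1/10 * y -> `|complex.Re z| <= y / 10 /\
   9/10 * y <= y + complex.Im z <= 11/10 * y.
  move=> zy; have := le_trans (normr_Re_le z) zy; have := le_trans (normr_Im_le z) zy.
  rewrite !ler_norml => /andP[u1 u2] /andP[v1 v2]; split; apply/andP; split; lra.
have [/= n1a n1b] := bd _ n1; have [/= n2a n2b] := bd _ n2.
pose f x : R[i] := (- y ^+ 2)%:C * ((w - x%:C)^-1 * (w' - x%:C)^-1).
have fE x : f x = ((- y ^+ 2)%:C / (w' - w)) * ((w - x%:C)^-1 + -1 * (w' - x%:C)^-1).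
  rewrite /f; move: (resolvent_neq0 x w0) (resolvent_neq0 x w0') => q1 q2.
  by field; rewrite q1 q2.
have rw := bounded_measurable_resolvent setT w0.
have rw' := bounded_measurable_resolvent setT w0'.
have pT := probability_setT nu.
have bf : bounded_measurable setT f.
  apply: bounded_measurableM; first exact: bounded_measurable_cst.
  exact: bounded_measurableM.
have Ef : complex_expectation nu f = 0.
  have -> : f = fun x => ((- y ^+ 2)%:C / (w' - w)) * ((w - x%:C)^-1 + -1 * (w' - x%:C)^-1).
    by apply/funext => x; exact: fE.
  have b1 := bounded_measurableM (bounded_measurable_cst setT (-1)) rw'.
  rewrite (complex_expectationZ measurableT pT); last exact: bounded_measurableD.
  rewrite (complex_expectationD measurableT pT)//.
  rewrite (complex_expectationZ measurableT pT)//.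
  by rewrite -!cauchy_transformE Gw Gw' mulN1r subrr mulr0.
pose A : set (measurableTypeR R) := ~` `[- M, M]%classic.
have mA : measurable A by exact: measurableC.
have bA : bounded_measurable setT (fun x : R => (\1_A x)%:C : R[i]).
  apply: (@bounded_measurable_real _ _ _ 1) => // x _.
  by rewrite indicE; case: (_ \in _); rewrite ?normr1 ?normr0.
(* The real part of [f] is at least 2/5 on [[-M, M]] and at least -1 on its complement [A], hence at
   least [2/5 - 7/5 1_A] everywhere. As [f] integrates to 0, this gives [nu A >= 2/7], against the
   tail bound 1/10. *)
have fge x : 0 <= complex.Re (f x + ((- (2/5))%:C + (7/5)%:C * (\1_A x)%:C)).
  have := @resolvent_product_bounds y c (y + d) c' (y + d') x n1a n2a n1b n2b y0.
  set F := (X in let f := X in _); cbv zeta => -[F1 F2].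
  have -> : complex.Re (f x + ((- (2/5))%:C + (7/5)%:C * (\1_A x)%:C)) =
     F + (- (2/5) + 7/5 * \1_A x).
    have RE (z : R[i]) (u v t : R) :
        complex.Re (z + (u%:C + v%:C * t%:C)) = complex.Re z + (u + v * t).
      by rewrite !cReD cReM /= mulr0 subr0.
    rewrite RE /f cReM; congr (_ + _).
    rewrite [complex.Im (- y ^+ 2)%:C]/= mul0r subr0 cReM !cReV !cImV.
    rewrite !(cReD, cReN, cImD, cImN) /= oppr0 !add0r !addr0 /F.
    have p1 : (c - x) ^+ 2 + (y + d) ^+ 2 != 0.
      by rewrite gt_eqF// ltr_wpDl ?sqr_ge0// exprn_gt0//; lra.
    have p2 : (c' - x) ^+ 2 + (y + d') ^+ 2 != 0.
      by rewrite gt_eqF// ltr_wpDl ?sqr_ge0// exprn_gt0//; lra.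
    by field; rewrite p1 p2.
  rewrite indicE; case: (boolP (x \in A)) => xA; first by rewrite mulr1; lra.
  rewrite mulr0; suff : 2/5 <= F by lra.
  apply: F1; move: xA; rewrite notin_setE /A /= => /contrapT.
  by rewrite in_itv /= -ler_norml => xM; apply: le_trans xM _; lra.
have bc : bounded_measurable setT (fun x : R => (7/5)%:C * (\1_A x)%:C : R[i]).
  by apply: bounded_measurableM => //; exact: bounded_measurable_cst.
have bb := bounded_measurableD (bounded_measurable_cst setT (- (2/5) : R)%:C) bc.
have := complex_expectation_ge0 measurableT pT (bounded_measurableD bf bb) (fun x _ => fge x).
rewrite (complex_expectationD measurableT pT bf bb) Ef add0r.
rewrite (complex_expectationD measurableT pT (bounded_measurable_cst setT _) bc).
rewrite (complex_expectationZ measurableT pT _ bA) complex_expectation_cst.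
rewrite complex_expectation_real// -rmorphM -rmorphD /=.
have -> : \int[nu]_x \1_A x = fine (nu A).
  by rewrite /Rintegral integral_indic// setIT.
have : (nu A \is a fin_num) by exact: fin_num_measure.
move: tM; rewrite -/A; move: (nu A) => [r| |]//=; rewrite lee_fin => ? _; lra.
Qed.

Lemma cauchy_transform_eq_measure mu nu :
  (forall A : set (measurableTypeR R), measurable A -> mu A = nu A) ->
  cauchy_transform mu = cauchy_transform nu.
Proof.
move=> mn; apply/funext => z; rewrite /cauchy_transform /Rintegral.
by congr (fine _ +i* fine _); apply: eq_measure_integral => A mA _; exact: mn.
Qed.

(** Each convolution step brings its own existentially quantified transforms on its own Stolz
    domain. Uniqueness on the axis identifies them near infinity with the given [phi] and [psi], and
    additivity then accumulates along the induction. *)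
Lemma axis_transform_power nu n mu phi psi :
  free_convolution_power nu n mu -> axis_transform mu phi -> axis_transform nu psi ->
  exists Y : R, forall y, Y < y -> phi y = psi y *+ n.
Proof.
move=> pw; elim: pw phi psi => {n mu} [mu mn|n rho mu _ IH fc] phi psi tphi tpsi.
  have [Y HY] := axis_transform_unique (fun z _ =>
    congr1 (fun g => g z) (cauchy_transform_eq_measure mn)) tphi tpsi.
  by exists Y => y /HY ->.
have [a [b [p_rho [p_nu [p_mu [[a0 b0] v1 v2 v3 H]]]]]] := fc.
have t1 := voiculescu_axis a0 v1.
have t2 := voiculescu_axis a0 v2.
have t3 := voiculescu_axis a0 v3.
have [Y1 H1] := axis_transform_unique (fun z _ => erefl) tphi t3.
have [Y2 H2] := axis_transform_unique (fun z _ => erefl) tpsi t2.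
have [Y3 H3] := IH _ _ t1 t2.
exists (Num.max (Num.max Y1 Y2) (Num.max (Num.max Y3 b) 0)) => y.
rewrite !gt_max => /andP[/andP[y1 y2] /andP[/andP[y3 yb] y0]].
rewrite H1// H2// H; last by split => //=; rewrite normr0 mulr_gt0.
by rewrite H3// mulrSr.
Qed.

End uniqueness.

(** * Asymptotic expansions *)

Section asymptotics.
Variable R : realType.
Implicit Types (f g : R -> R[i]) (P Q : R -> Prop).

Definition near0 P : Prop := exists2 e0 : R, 0 < e0 & forall e, 0 < e -> e < e0 -> P e.

Definition Oat0 k f : Prop :=
  exists C : R, near0 (fun e => normc (f e) <= C * e ^+ k).

Lemma near0I P Q : near0 P -> near0 Q -> near0 (fun e => P e /\ Q e).
Proof.
move=> [e0 p0 HP] [e1 p1 HQ]; exists (Num.min e0 e1); first by rewrite lt_min p0.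
by move=> e ep; rewrite lt_min => /andP[l0 l1]; split; [exact: HP|exact: HQ].
Qed.

Lemma near0S P Q : (forall e, 0 < e -> P e -> Q e) -> near0 P -> near0 Q.
Proof. by move=> PQ [e0 p0 HP]; exists e0 => // e ep le0; exact/PQ/HP. Qed.

Lemma near0_scale P (s : R) : 0 < s -> near0 P -> near0 (fun e => P (s * e)).
Proof.
move=> s0 [e0 p0 HP]; exists (e0 / s); first exact: divr_gt0.
by move=> e ep; rewrite ltr_pdivlMr// mulrC => le0; apply: HP => //; exact: mulr_gt0.
Qed.

Lemma near0_lt (c : R) : 0 < c -> near0 (fun e => e < c).
Proof. by move=> c0; exists c. Qed.

(** The passage from large [y] to the small parameter [e = 1/y]; the maximum with 1 keeps the
    threshold positive. *)
Lemma near0_large P : (exists Y : R, forall y, Y < y -> P y) -> near0 (fun e => P e^-1).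
Proof.
move=> [Y HY]; exists (Num.max 1 Y)^-1; first by rewrite invr_gt0 lt_max ltr01.
move=> e e0; rewrite -[e in e < _]invrK ltf_pV2 ?posrE ?invr_gt0 ?lt_max ?ltr01//.
by rewrite gt_max => /andP[_ /HY].
Qed.

Lemma Oat0_near k f g : near0 (fun e => f e = g e) -> Oat0 k f -> Oat0 k g.
Proof.
move=> fg [C fC]; exists C; have := near0I fg fC.
by apply: near0S => e _ [->].
Qed.

Lemma eq_Oat0 k f g : f =1 g -> Oat0 k f -> Oat0 k g.
Proof. by move=> /funext ->. Qed.

Lemma Oat0D k f g : Oat0 k f -> Oat0 k g -> Oat0 k (fun e => f e + g e).
Proof.
move=> [C fC] [D gD]; exists (C + D); have := near0I fC gD.
apply: near0S => e _ [h1 h2]; rewrite mulrDl.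
exact: le_trans (le_normcD _ _) (lerD h1 h2).
Qed.

Lemma Oat0M k l f g : Oat0 k f -> Oat0 l g -> Oat0 (k + l) (fun e => f e * g e).
Proof.
move=> [C fC] [D gD]; exists (C * D); have := near0I fC gD.
apply: near0S => e _ [h1 h2]; rewrite normcM exprD mulrACA.
by apply: ler_pM => //; exact: normc_ge0.
Qed.

Lemma Oat0_cst z : Oat0 0 (fun=> z).
Proof. by exists (normc z); exists 1 => // e _ _; rewrite mulr1. Qed.

Lemma Oat0Z k z f : Oat0 k f -> Oat0 k (fun e => z * f e).
Proof. exact: Oat0M (Oat0_cst z). Qed.

Lemma Oat0N k f : Oat0 k f -> Oat0 k (fun e => - f e).
Proof. by move=> /(Oat0Z (-1)); apply: eq_Oat0 => e; rewrite mulN1r. Qed.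

Lemma Oat0B k f g : Oat0 k f -> Oat0 k g -> Oat0 k (fun e => f e - g e).
Proof. by move=> Of /Oat0N; exact: Oat0D. Qed.

Lemma Oat0J k f : Oat0 k f -> Oat0 k (fun e => conjc (f e)).
Proof.
by move=> [C fC]; exists C; apply: near0S fC => e _; rewrite normc_conj.
Qed.

Lemma Oat0_id : Oat0 1 (fun e => e%:C).
Proof.
by exists 1; exists 1 => // e e0 _; rewrite normc_real gtr0_norm// mul1r expr1.
Qed.

Lemma Oat0X k n f : Oat0 k f -> Oat0 (n * k) (fun e => f e ^+ n).
Proof.
move=> Of; elim: n => [|n IH].
  by apply: eq_Oat0 (Oat0_cst 1) => e; rewrite expr0.
by rewrite mulSn; apply: eq_Oat0 (Oat0M Of IH) => e; rewrite exprS.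
Qed.

Lemma Oat0W l k f : (k <= l)%N -> Oat0 l f -> Oat0 k f.
Proof.
move=> kl [C fC]; exists `|C|; have := near0I fC (near0_lt ltr01).
apply: near0S => e e0 [h e1]; apply: le_trans h _.
apply: le_trans (_ : `|C| * e ^+ l <= _).
  by apply: ler_wpM2r; [exact/exprn_ge0/ltW|exact: ler_norm].
by apply: ler_wpM2l => //; apply: ler_wiXn2l => //; exact: ltW.
Qed.

Lemma Oat0_scale k f (s : R) : 0 < s -> Oat0 k f -> Oat0 k (fun e => f (s * e)).
Proof.
move=> s0 [C fC]; exists (C * s ^+ k); have := near0_scale s0 fC.
by apply: near0S => e _; rewrite exprMn mulrA.
Qed.

Lemma Oat0_div k f : Oat0 k.+1 f -> Oat0 k (fun e => f e * e^-1%:C).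
Proof.
move=> [C fC]; exists C; apply: near0S fC => e e0 h.
rewrite normcM normc_real gtr0_norm ?invr_gt0//.
by rewrite ler_pdivrMr// -mulrA -exprSr.
Qed.

Lemma Oat01_lt f (c : R) : 0 < c -> Oat0 1 f -> near0 (fun e => normc (f e) < c).
Proof.
move=> c0 [C fC]; have C1 : 0 < `|C| + 1 by rewrite ltr_wpDl.
have := near0I fC (near0_lt (divr_gt0 c0 C1)).
apply: near0S => e e0 [h]; rewrite ltr_pdivlMr// expr1 in h *.
apply: le_lt_trans; apply: le_trans h _.
by rewrite mulrC ler_pM2l// (le_trans (ler_norm _))// lerDl.
Qed.

Lemma Oat0_inv1 f : Oat0 1 f ->
  near0 (fun e => 1 - f e != 0) /\ Oat0 0 (fun e => (1 - f e)^-1).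
Proof.
move=> Of; have h2 : (0 : R) < 1/2 by lra.
have lb e : normc (f e) < 1/2 -> 1/2 <= normc (1 - f e).
  move=> h; have : normc (1 : R[i]) <= normc (1 - f e) + normc (f e).
    by rewrite -{1}(subrK (f e) 1); exact: le_normcD.
  by rewrite normc1; lra.
split.
  apply: near0S (Oat01_lt h2 Of) => e _ /lb h; apply/eqP => E.
  by move: h; rewrite E normc0; lra.
exists 2; apply: near0S (Oat01_lt h2 Of) => e _ /lb h.
rewrite normcV expr0 mulr1 -[leRHS]invrK lef_pV2 ?posrE ?invr_gt0//; lra.
Qed.

(** A negative [c] would win over the remainder: for [e < - c / (|C| + 1)] the bound [C e^(k+1)] is
    smaller than [- c e^k], which makes the real part of [f] negative. *)
Lemma Oat0_leading_ge0 k f (c : R) :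
  near0 (fun e => 0 <= complex.Re (f e)) ->
  Oat0 k.+1 (fun e => f e - c%:C * e%:C ^+ k) -> 0 <= c.
Proof.
move=> f0 [C fC]; rewrite leNgt; apply/negP => c0.
have C1 : 0 < `|C| + 1 by rewrite ltr_wpDl.
have nc : 0 < - c by lra.
have [e0 e0p H] := near0I (near0I f0 fC) (near0_lt (divr_gt0 nc C1)).
have e2 : 0 < e0 / 2 by rewrite divr_gt0.
have [[h1 h2] h3] := H (e0 / 2) e2 ltac:(lra).
move: e2 h1 h2 h3.
move: (e0 / 2) => e ep h1 h2; rewrite ltr_pdivlMr// => h3.
have := le_trans (normr_Re_le _) h2.
have RE : complex.Re (c%:C * e%:C ^+ k) = c * e ^+ k by rewrite -rmorphXn -rmorphM.
rewrite cReD cReN RE => /(le_trans (ler_norm _)).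
rewrite exprS mulrA; have ek : 0 < e ^+ k by rewrite exprn_gt0.
move=> h4; have : - c * e ^+ k <= C * e * e ^+ k by lra.
rewrite ler_pM2r// => h5.
have := ler_norm C; have : e * C <= e * `|C| by rewrite ler_pM2l// ler_norm.
by nra.
Qed.

End asymptotics.

(** * Inversion of the moment series *)

Section inversion.
Variable R : realType.

(** In the application [u] is the value [1/z] of the Cauchy transform at [w], and [v = 1/(w - m)];
    the hypothesis is the expansion of the transform in central moments, the conclusion its
    inversion, the R-transform. The coefficient [c4 - 2 c2^2] is the fourth free cumulant of a
    centered law. With [d = u/v - 1], the difference [1/v - 1/u] is [d/u], so it suffices to compare
    [d] with [c2 u^2 + c3 u^3 + k4 u^4] up to order 5. *)
Lemma cumulant_expansion (c2 c3 c4 : R) (u v rho : R -> R[i]) :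
  Oat0 1 v -> Oat0 5 rho ->
  near0 (fun e => u e = v e * (1 + (c2%:C * v e ^+ 2 + c3%:C * v e ^+ 3
     + c4%:C * v e ^+ 4 + rho e))) ->
  near0 (fun e => v e != 0) ->
  near0 (fun e => u e = - 'i * e%:C) ->
  Oat0 4 (fun e => (v e)^-1 - (u e)^-1 -
    (c2%:C * u e + c3%:C * u e ^+ 2 + (c4 - 2 * c2 ^+ 2)%:C * u e ^+ 3)).
Proof.
move=> Ov Orho uv v0 ue.
pose d e := c2%:C * v e ^+ 2 + c3%:C * v e ^+ 3 + c4%:C * v e ^+ 4 + rho e.
pose k4 : R[i] := c4%:C - 2 * c2%:C ^+ 2.
have k4E : (c4 - 2 * c2 ^+ 2)%:C = k4.
  by rewrite rmorphB rmorphM rmorphXn /k4; congr (_ - _ * _); rewrite rmorphMn.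
have Od2 : Oat0 2 d.
  do !apply: Oat0D.
  - exact/Oat0Z/(Oat0X 2 Ov).
  - exact/Oat0Z/(Oat0W _ (Oat0X 3 Ov)).
  - exact/Oat0Z/(Oat0W _ (Oat0X 4 Ov)).
  - exact: Oat0W Orho.
have Od3 : Oat0 3 (fun e => d e - c2%:C * v e ^+ 2).
  apply: (@eq_Oat0 _ _ (fun e => c3%:C * v e ^+ 3 + c4%:C * v e ^+ 4 + rho e)).
    by move=> e; rewrite /d; ring.
  do !apply: Oat0D.
  - exact/Oat0Z/(Oat0X 3 Ov).
  - exact/Oat0Z/(Oat0W _ (Oat0X 4 Ov)).
  - exact: Oat0W Orho.
pose del e := v e * d e.
have Odel : Oat0 3 del by exact: (Oat0M Ov Od2).
have Odel4 : Oat0 4 (fun e => del e - c2%:C * v e ^+ 3).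
  by apply: eq_Oat0 (Oat0M Ov Od3) => e; rewrite /del; ring.
have O0v : Oat0 0 v by exact: Oat0W Ov.
have O0del : Oat0 0 del by exact: Oat0W Odel.
(* [X] is [d - (c2 u^2 + c3 u^3 + k4 u^4)] expanded at [u = v + del] and grouped so that every
   summand is visibly of order 5. The cross term [2 c2 v del] of [c2 u^2] contributes [2 c2^2 v^4],
   which turns [c4] into [k4]. *)
pose X e := rho e - 2 * c2%:C * (v e * (del e - c2%:C * v e ^+ 3)) -
  c2%:C * (del e * del e) -
  c3%:C * (del e * (3 * v e ^+ 2 + (3 * (v e * del e) + del e * del e))) -
  k4 * (del e * (4 * v e ^+ 3 + (6 * (v e ^+ 2 * del e) +
                (4 * (v e * (del e * del e)) + del e * (del e * del e))))).
have OX : Oat0 5 X.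
  have v2 := Oat0X 2 Ov; have v3 := Oat0X 3 Ov.
  have dd := Oat0M Odel Odel.
  do !apply: Oat0B.
  - exact: Orho.
  - exact/Oat0Z/(Oat0M Ov Odel4).
  - exact/Oat0Z/(Oat0W _ dd).
  - apply: Oat0Z; apply: (Oat0M Odel (_ : Oat0 2 _)).
    do !apply: Oat0D; first exact/Oat0Z/v2.
    + by apply: Oat0Z; exact: (Oat0W _ (Oat0M Ov Odel)).
    + exact: (Oat0W _ dd).
  - apply: Oat0Z; apply: (Oat0M Odel (_ : Oat0 2 _)).
    do !apply: Oat0D; first exact/Oat0Z/(Oat0W _ v3).
    + by apply: Oat0Z; exact: (Oat0W _ (Oat0M v2 Odel)).
    + by apply: Oat0Z; exact: (Oat0W _ (Oat0M Ov dd)).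
    + exact: (Oat0W _ (Oat0M Odel dd)).
apply: Oat0_near (Oat0Z 'i (Oat0_div OX)).
have := near0I (near0I uv v0) ue; apply: near0S => e e0 [[h1 h2] h3].
rewrite k4E.
have u0 : u e != 0.
  rewrite h3 mulf_neq0 ?oppr_eq0//.
    by rewrite eq_complex /= negb_and oner_eq0 orbT.
  by rewrite eq_complex /= negb_and (gt_eqF e0).
have hu : u e = v e + del e by rewrite h1 /del /d; ring.
have ie : 'i * e^-1%:C = (u e)^-1.
  have ii : 'i * 'i = -1 :> R[i] by rewrite -expr2 sqr_i.
  rewrite h3 invfM fmorphV; congr (_ * _).
  by apply: (@mulfI _ (- 'i)); rewrite ?mulfV ?mulNr ?ii ?opprK// oppr_eq0
    eq_complex /= negb_and oner_eq0 orbT.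
rewrite mulrCA ie.
have -> : X e = d e - (c2%:C * u e ^+ 2 + c3%:C * u e ^+ 3 + k4 * u e ^+ 4).
  rewrite hu /X.
  have -> : rho e = d e - (c2%:C * v e ^+ 2 + c3%:C * v e ^+ 3 + c4%:C * v e ^+ 4).
    by rewrite /d; ring.
  by rewrite /k4; ring.
have -> : d e = (u e - v e) / v e by rewrite hu /del; field.
by field; rewrite u0.
Qed.

End inversion.

(** * Positivity of the Gram matrix *)

Section gram.
Variables (R : realType) (nu : probability (measurableTypeR R) R).
Let mT := @measurableT _ (measurableTypeR R).
Let nuT := probability_setT nu.

Definition resolvent_test (z w : R[i]) (x : R) : R[i] := z * (w - x%:C)^-1 + -1.

Lemma bounded_measurable_resolvent_test z w : 0 < complex.Im w ->
  bounded_measurable setT (resolvent_test z w).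
Proof.
move=> w0; apply: bounded_measurableD; last exact: bounded_measurable_cst.
apply: bounded_measurableM; first exact: bounded_measurable_cst.
exact: bounded_measurable_resolvent.
Qed.

(* [G w = z^-1] and [G w' = z'^-1] turn the resolvent identity into a formula that
   no longer involves [nu]. *)
Lemma expectation_resolvent_test z w z' w' :
  0 < complex.Im w -> 0 < complex.Im w' -> z != 0 -> z' != 0 ->
  cauchy_transform nu w = z^-1 -> cauchy_transform nu w' = z'^-1 ->
  complex_expectation nu (fun x => resolvent_test z w x * conjc (resolvent_test z' w' x)) =
  (conjc z' - z) / (conjc w' - w) - 1.
Proof.
move=> w0 w0' z0 z0' Gw Gw'.
have r1 := bounded_measurable_resolvent setT w0.
have r2 := bounded_measurableJ (bounded_measurable_resolvent setT w0').
have ww : conjc w' - w != 0.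
  apply/eqP => /(congr1 (@complex.Im R)); rewrite cImD cImN cImJ /=; lra.
have zz : conjc z' != 0 by rewrite conjc_eq0.
have E x : resolvent_test z w x * conjc (resolvent_test z' w' x) =
    (z * conjc z' / (conjc w' - w) - z) * (w - x%:C)^-1 +
    ((- (z * conjc z' / (conjc w' - w)) - conjc z') * conjc ((w' - x%:C)^-1) + 1).
  rewrite /resolvent_test !(conjcD, conjcM, conjcN, conjc1, conjc_inv, conjc_real).
  have h1 := resolvent_neq0 x w0.
  have h2 : conjc w' - x%:C != 0.
    rewrite -(conjc_real x) -conjcN -conjcD conjc_eq0; exact: resolvent_neq0.
  by field; rewrite h1 h2 ww.
rewrite (funext E).
have bz c := bounded_measurable_cst (setT : set (measurableTypeR R)) (c : R[i]).
have b1 := bounded_measurableM (bz (z * conjc z' / (conjc w' - w) - z)) r1.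
have b2 := bounded_measurableM (bz (- (z * conjc z' / (conjc w' - w)) - conjc z')) r2.
rewrite (complex_expectationD mT nuT b1 (bounded_measurableD b2 (bz 1))).
rewrite (complex_expectationD mT nuT b2 (bz 1)).
rewrite (complex_expectationZ mT nuT _ r1) (complex_expectationZ mT nuT _ r2).
rewrite (complex_expectationJ mT nuT (bounded_measurable_resolvent setT w0')).
rewrite complex_expectation_cst -!cauchy_transformE Gw Gw' conjc_inv.
by field; rewrite z0 zz ww.
Qed.

(** The form is the expectation of [|d1 f1 + d2 f2|^2], where [f_j] is the test function
    [resolvent_test z_j w_j]. *)
Lemma gram_resolvent_test_ge0 (d1 d2 z1 w1 z2 w2 : R[i]) :
  0 < complex.Im w1 -> 0 < complex.Im w2 -> z1 != 0 -> z2 != 0 ->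
  cauchy_transform nu w1 = z1^-1 -> cauchy_transform nu w2 = z2^-1 ->
  let N (z w z' w' : R[i]) := (conjc z' - z) / (conjc w' - w) - 1 in
  0 <= complex.Re (d1 * conjc d1 * N z1 w1 z1 w1 + d1 * conjc d2 * N z1 w1 z2 w2 +
                   (d2 * conjc d1 * N z2 w2 z1 w1 + d2 * conjc d2 * N z2 w2 z2 w2)).
Proof.
move=> w10 w20 z10 z20 G1 G2; cbv zeta.
have t1 := bounded_measurable_resolvent_test z1 w10.
have t2 := bounded_measurable_resolvent_test z2 w20.
have bb f g (bf : bounded_measurable setT f) (bg : bounded_measurable setT g) :
    bounded_measurable (setT : set (measurableTypeR R)) (fun x => f x * conjc (g x)).
  by apply: bounded_measurableM => //; exact: bounded_measurableJ.
have bz c := bounded_measurable_cst (setT : set (measurableTypeR R)) (c : R[i]).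
rewrite -!expectation_resolvent_test//.
rewrite -!(complex_expectationZ mT nuT); try exact: bb.
have c1 := bounded_measurableM (bz (d1 * conjc d1)) (bb _ _ t1 t1).
have c2 := bounded_measurableM (bz (d1 * conjc d2)) (bb _ _ t1 t2).
have c3 := bounded_measurableM (bz (d2 * conjc d1)) (bb _ _ t2 t1).
have c4 := bounded_measurableM (bz (d2 * conjc d2)) (bb _ _ t2 t2).
rewrite -(complex_expectationD mT nuT c1 c2) -(complex_expectationD mT nuT c3 c4).
rewrite -(complex_expectationD mT nuT (bounded_measurableD c1 c2) (bounded_measurableD c3 c4)).
apply: (complex_expectation_ge0 mT nuT).
  by apply: bounded_measurableD; exact: bounded_measurableD.
move=> x _.
move: (resolvent_test z1 w1 x) (resolvent_test z2 w2 x) => f1 f2.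
have -> : d1 * conjc d1 * (f1 * conjc f1) + d1 * conjc d2 * (f1 * conjc f2) +
   (d2 * conjc d1 * (f2 * conjc f1) + d2 * conjc d2 * (f2 * conjc f2)) =
   (d1 * f1 + d2 * f2) * conjc (d1 * f1 + d2 * f2).
  by rewrite conjcD !conjcM; ring.
rewrite cReM cReJ cImJ mulrN opprK -!expr2.
by rewrite addr_ge0// sqr_ge0.
Qed.

End gram.

(** * From the Gram matrix to a quadratic inequality for the free cumulants *)

Section hankel.
Variable R : realType.
Implicit Types (r s t : R) (psi : R -> R[i]).

Let ii : 'i * 'i = -1 :> R[i].
Proof. by rewrite -expr2 sqr_i. Qed.

Let i_neq0 : 'i != 0 :> R[i].
Proof. by rewrite eq_complex /= negb_and oner_eq0 orbT. Qed.

Let real_neq0 (s : R) : 0 < s -> s%:C != 0 :> R[i].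
Proof. by move=> s0; rewrite eq_complex /= negb_and (gt_eqF s0). Qed.

(** Here [psi e] stands for [phi_mu z - m] at [z = i/e], and [u = - i e] is [1/z]. *)
Definition cumulant_remainder (k2 k3 k4 : R) psi (e : R) : R[i] :=
  let u := - 'i * e%:C in
  psi e - (k2%:C * u + k3%:C * u ^+ 2 + k4%:C * u ^+ 3).

(** The kernel [K] at [z_s = i/(s e)] and [z_t = i/(t e)]: the prefactor is [1 / (conj z_t - z_s)],
    and the real mean [m] has cancelled in the difference. *)
Definition pick_kernel psi s t (e : R) : R[i] :=
  ('i * e%:C * (s%:C * t%:C / (s%:C + t%:C))) * (psi (s * e) - conjc (psi (t * e))).

(** Each difference [(- i s)^k - (i t)^k] is divisible by [s + t], so that the truncated kernel is a
    polynomial in [s] and [t]. *)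
Definition pick_kernel_expansion (k2 k3 k4 : R) s t (e : R) : R[i] :=
  s%:C * t%:C * (k2%:C * e%:C ^+ 2 + k3%:C * 'i * e%:C ^+ 3 * (t%:C - s%:C) +
  k4%:C * e%:C ^+ 4 * (s%:C * t%:C - s%:C ^+ 2 - t%:C ^+ 2)).

Lemma pick_kernel_expand (k2 k3 k4 : R) psi s t : 0 < s -> 0 < t ->
  Oat0 4 (cumulant_remainder k2 k3 k4 psi) ->
  Oat0 5 (fun e => pick_kernel psi s t e - pick_kernel_expansion k2 k3 k4 s t e).
Proof.
move=> s0 t0 H.
have O1 := Oat0B (Oat0_scale s0 H) (Oat0J (Oat0_scale t0 H)).
have := Oat0M (Oat0Z ('i * (s%:C * t%:C / (s%:C + t%:C))) (@Oat0_id R)) O1.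
apply: eq_Oat0 => e; rewrite /pick_kernel /cumulant_remainder /pick_kernel_expansion.
rewrite !(conjcD, conjcM, conjcN, conjcX, conjc_real, conjci) !rmorphM.
have st : s%:C + t%:C != 0 :> R[i] by rewrite -rmorphD real_neq0// addr_gt0.
have i3 : 'i ^+ 3 = - 'i :> R[i] by rewrite exprS sqr_i mulrN1.
have i4 : 'i ^+ 4 = 1 :> R[i] by rewrite exprS i3 mulrN ii opprK.
move: (psi _) (conjc (psi _)) st i3 i4 ii => X Y st i3 i4 i2.
field: i3 i4 i2 => //.
Qed.

(** The terms up to [e^4] of [r K + (r K)^2 + ...]. Since [K] has order [e^2], the cube is of order
    [e^6] and only the [k2] part of [K] survives in the square, which is the source of [r k2^2]. *)
Definition gram_expansion (k2 k3 k4 : R) r s t (e : R) : R[i] :=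
  r%:C * pick_kernel_expansion k2 k3 k4 s t e +
  (r%:C * (s%:C * t%:C * k2%:C * e%:C ^+ 2)) ^+ 2.

Lemma gram_expand (k2 k3 k4 : R) psi r s t : 0 < s -> 0 < t ->
  Oat0 4 (cumulant_remainder k2 k3 k4 psi) ->
  Oat0 5 (fun e => ((1 - r%:C * pick_kernel psi s t e)^-1 - 1) -
                   gram_expansion k2 k3 k4 r s t e).
Proof.
move=> s0 t0 /(pick_kernel_expand s0 t0).
set K := pick_kernel psi s t; set L := pick_kernel_expansion k2 k3 k4 s t => OKL.
pose M e : R[i] := s%:C * t%:C * k2%:C * e%:C ^+ 2.
have OX n (z : R[i]) : Oat0 n (fun e => z * e%:C ^+ n).
  by apply: Oat0Z; have := Oat0X n (@Oat0_id R); rewrite muln1.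
have OM : Oat0 2 M by exact: OX.
have OLM : Oat0 3 (fun e => L e - M e).
  apply: (@eq_Oat0 _ _ (fun e => s%:C * t%:C * (k3%:C * 'i * (t%:C - s%:C)) * e%:C ^+ 3 +
    s%:C * t%:C * (k4%:C * (s%:C * t%:C - s%:C ^+ 2 - t%:C ^+ 2)) * e%:C ^+ 4)).
    by move=> e; rewrite /L /M /pick_kernel_expansion; ring.
  by apply: Oat0D; [exact: OX|exact: Oat0W (OX 4 _)].
have OKM : Oat0 3 (fun e => K e - M e).
  apply: (@eq_Oat0 _ _ (fun e => (K e - L e) + (L e - M e))).
    by move=> e; ring.
  by apply: Oat0D => //; exact: Oat0W OKL.
have OK : Oat0 2 K.
  apply: (@eq_Oat0 _ _ (fun e => (K e - M e) + M e)); first by move=> e; rewrite subrK.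
  by apply: Oat0D => //; exact: Oat0W OKM.
have OrK : Oat0 2 (fun e => r%:C * K e) by exact: Oat0Z.
have [nz Oinv] := Oat0_inv1 (Oat0W (isT : (1 <= 2)%N) OrK).
apply: (@Oat0_near _ _ (fun e => r%:C * (K e - L e) +
   (r%:C ^+ 2 * ((K e - M e) * (K e + M e)) + (r%:C * K e) ^+ 3 * (1 - r%:C * K e)^-1))).
  apply: near0S nz => e _ h; rewrite /gram_expansion -/L -/(M e).
  by field.
apply: Oat0D; first exact: Oat0Z.
apply: Oat0D; first by apply: Oat0Z; apply: (Oat0M OKM); exact: Oat0D.
exact: (Oat0W _ (Oat0M (Oat0X 3 OrK) Oinv)).
Qed.

Definition axis_point (e : R) : R[i] := 'i * e^-1%:C.

(** The point [w = z + r phi_mu z] at [z = i/e], with the mean [m] split off from [phi_mu]. *)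
Definition subordinate_point psi (m r e : R) : R[i] :=
  axis_point e + (r * m)%:C + r%:C * psi e.

Lemma axis_point_neq0 (e : R) : 0 < e -> axis_point e != 0.
Proof. by move=> e0; rewrite /axis_point mulf_neq0// real_neq0// invr_gt0. Qed.

(** The real shift [r m] cancels, and [conj w_t - w_s = (conj z_t - z_s) (1 - r K)]. *)
Lemma gram_pick_kernel psi (m r s t e : R) : 0 < s -> 0 < t -> 0 < e ->
  (conjc (axis_point (t * e)) - axis_point (s * e)) /
  (conjc (subordinate_point psi m r (t * e)) - subordinate_point psi m r (s * e)) =
  (1 - r%:C * pick_kernel psi s t e)^-1.
Proof.
move=> s0 t0 e0; rewrite /subordinate_point.
set D := conjc (axis_point (t * e)) - axis_point (s * e).
have st : s%:C + t%:C != 0 :> R[i] by rewrite -rmorphD real_neq0// addr_gt0.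
have sn := real_neq0 s0; have tn := real_neq0 t0; have en := real_neq0 e0.
have DE : D = - 'i * (s%:C + t%:C) / (s%:C * t%:C * e%:C).
  rewrite /D /axis_point conjcM conjci conjc_real !fmorphV !rmorphM.
  by field; rewrite sn tn en.
have D0 : D != 0.
  by rewrite DE !mulf_neq0 ?invr_eq0 ?mulf_neq0 ?oppr_eq0.
have -> : conjc (axis_point (t * e) + (r * m)%:C + r%:C * psi (t * e)) -
    (axis_point (s * e) + (r * m)%:C + r%:C * psi (s * e)) =
    D * (1 - r%:C * pick_kernel psi s t e).
  have DK : D * pick_kernel psi s t e = psi (s * e) - conjc (psi (t * e)).
    rewrite DE /pick_kernel.
    move: (psi (s * e)) (conjc (psi (t * e))) ii => X Y i2.
    by field: i2; rewrite sn tn en st.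
  rewrite mulrBr mulr1 mulrCA DK /D.
  move: (axis_point _) (axis_point _) (psi _) (psi _) => A B X Y.
  by rewrite !conjcD conjcM !conjc_real; ring.
by rewrite invfM mulrA mulfV// mul1r.
Qed.

(** Formally, with [x] counted from [r m], each test function is [u_j x + u_j^2 (x^2 - r k2) + ...]
    with [u_j = - i j e]. The chosen combination is [2 e^2 (a x + b (x^2 - r k2))] to leading order,
    so its squared norm is [4 r e^4] times the quadratic form. The proof obtains this from the
    expansion of the kernel, without moments of [nu]. *)
Lemma hankel_of_subordinate (nu : probability (measurableTypeR R) R)
    (k2 k3 k4 m r : R) psi : 0 < r ->
  near0 (fun e => 0 < complex.Im (subordinate_point psi m r e) /\
    cauchy_transform nu (subordinate_point psi m r e) = (axis_point e)^-1) ->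
  Oat0 4 (cumulant_remainder k2 k3 k4 psi) ->
  forall a b : R, 0 <= k2 * a ^+ 2 + 2 * k3 * a * b + (k4 + r * k2 ^+ 2) * b ^+ 2.
Proof.
move=> r0 H OR a b.
have two0 : (0 : R) < 2 by [].
have H1 := near0_scale ltr01 H; have H2 := near0_scale two0 H.
pose N s t e : R[i] := (1 - r%:C * pick_kernel psi s t e)^-1 - 1.
(* [d1 + 2 d2 = 2 i e a] and [d1 + 4 d2 = - 2 b] select the coefficients [k2], [k3]
   and [k4] at the same order [e^4]. *)
pose d1 e : R[i] := 4 * 'i * a%:C * e%:C + 2 * b%:C.
pose d2 e : R[i] := - 'i * a%:C * e%:C - b%:C.
pose c1 e : R[i] := - (4 * 'i * a%:C * e%:C) + 2 * b%:C.
pose c2 e : R[i] := 'i * a%:C * e%:C - b%:C.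
have conj2 n : conjc (n%:R : R[i]) = n%:R by exact: conjc_nat.
have d1E e : conjc (d1 e) = c1 e.
  by rewrite /d1 !(conjcD, conjcM, conjc_real, conj2, conjci) /c1; ring.
have d2E e : conjc (d2 e) = c2 e.
  by rewrite /d2 !(conjcD, conjcM, conjcN, conjc_real, conj2, conjci) /c2; ring.
pose F e := d1 e * c1 e * N 1 1 e + d1 e * c2 e * N 1 2 e +
  (d2 e * c1 e * N 2 1 e + d2 e * c2 e * N 2 2 e).
have F0 : near0 (fun e => 0 <= complex.Re (F e)).
  have := near0I H1 H2; apply: near0S => e e0 [[i1 G1] [i2 G2]].
  have := gram_resolvent_test_ge0 (d1 e) (d2 e) i1 i2 _ _ G1 G2.
  rewrite !axis_point_neq0 ?mulr_gt0// => /(_ isT isT).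
  by rewrite /F /N -!d1E -!d2E -!(gram_pick_kernel psi m)//.
have Oe0 : Oat0 0 (fun e : R => e%:C) by exact: Oat0W (@Oat0_id R).
have Od1 : Oat0 0 d1.
  by apply: Oat0D; [exact: Oat0Z|exact: Oat0_cst].
have Od2 : Oat0 0 d2.
  by apply: Oat0B; [exact: Oat0Z|exact: Oat0_cst].
have Oc1 : Oat0 0 c1.
  by apply: Oat0D; [apply: Oat0N; exact: Oat0Z|exact: Oat0_cst].
have Oc2 : Oat0 0 c2.
  by apply: Oat0B; [exact: Oat0Z|exact: Oat0_cst].
pose G s t e := gram_expansion k2 k3 k4 r s t e.
have ON s t : 0 < s -> 0 < t -> Oat0 5 (fun e => N s t e - G s t e).
  by move=> s0 t0; exact: gram_expand.
have O11 := Oat0M (Oat0M Od1 Oc1) (ON 1 1 ltr01 ltr01).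
have O12 := Oat0M (Oat0M Od1 Oc2) (ON 1 2 ltr01 two0).
have O21 := Oat0M (Oat0M Od2 Oc1) (ON 2 1 two0 ltr01).
have O22 := Oat0M (Oat0M Od2 Oc2) (ON 2 2 two0 two0).
(* The only term beyond [e^4] in the expanded form: it comes from the mixed products of [d1 + 2 d2]
   and [d1 + 8 d2] in the [k4] part. *)
have O6 : Oat0 5 (fun e : R => (16 * r%:C * k4%:C * a%:C ^+ 2) * e%:C ^+ 6).
  by apply: Oat0Z; exact: (Oat0W _ (Oat0X 6 (@Oat0_id R))).
set q := (X in 0 <= X).
suff : 0 <= 4 * r * q by rewrite pmulr_rge0// mulr_gt0.
apply: (Oat0_leading_ge0 F0 (k := 4)).
apply: eq_Oat0 (Oat0D (Oat0D (Oat0D O11 O12) (Oat0D O21 O22)) O6) => e.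
rewrite /F /G /gram_expansion /pick_kernel_expansion.
rewrite /q !(rmorphD, rmorphM, rmorphXn, rmorph1, rmorph_nat).
move: (N 1 1 e) (N 1 2 e) (N 2 1 e) (N 2 2 e) ii => N11 N12 N21 N22 i2.
rewrite /d1 /d2 /c1 /c2.
ring: i2.
Qed.

End hankel.

(** * The Hankel inequality for freely infinitely divisible laws of bounded support *)

Section free_infinite_divisibility.
Variables (R : realType) (mu : probability (measurableTypeR R) R).
Variables (D : set (measurableTypeR R)) (m : R).
Hypotheses (mD : measurable D) (muD : mu D = 1%E).
Hypothesis Dm : forall x : R, D x -> `|x - m| <= 1.

Definition central_moment (k : nat) : R := \int[mu]_x (x - m) ^+ k.
Local Notation c := central_moment.

Hypothesis c1 : c 1 = 0.

Lemma bounded_measurable_centered : bounded_measurable D (fun x : R => (x - m)%:C).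
Proof. by apply: (@bounded_measurable_real _ _ _ 1) => //; exact: measurable_funB. Qed.

Lemma expectation_centeredX k :
  complex_expectation mu (fun x => (x - m)%:C ^+ k) = (c k)%:C.
Proof.
rewrite -complex_expectation_real; congr (complex_expectation mu _).
by apply/funext => x; rewrite rmorphXn.
Qed.

(** The geometric series of [1/(w - x) = v / (1 - v X)] with [X = x - m], cut after [X^4]. The tail
    factor [X^5 / (1 - v X)] is at most 2 because [|v X| <= 1/2]; its expectation costs another
    factor 2. *)
Lemma cauchy_transform_expand (w : R[i]) (v := (w - m%:C)^-1) :
  0 < complex.Im w -> normc v <= 1/2 ->
  exists2 rho, cauchy_transform mu w =
      v * (1 + ((c 2)%:C * v ^+ 2 + (c 3)%:C * v ^+ 3 + (c 4)%:C * v ^+ 4 + rho)) &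
    normc rho <= 4 * normc v ^+ 5.
Proof.
move=> w0 v2.
have z0 : w - m%:C != 0 by exact: resolvent_neq0.
have v0 : v != 0 by rewrite invr_eq0.
pose X (x : R) : R[i] := (x - m)%:C.
have bX k : bounded_measurable D (fun x => X x ^+ k).
  by apply: bounded_measurableX; exact: bounded_measurable_centered.
have bres := bounded_measurable_resolvent D w0.
have bz z := bounded_measurable_cst D z.
pose rem (x : R) := X x ^+ 5 * (v^-1 * (w - x%:C)^-1).
have brem : bounded_measurable D rem.
  by apply: bounded_measurableM => //; exact: bounded_measurableM.
have E : (fun x : R => (w - x%:C)^-1) = fun x =>
    \sum_(k < 5) v ^+ k.+1 * X x ^+ k + v ^+ 6 * rem x.
  apply/funext => x; rewrite !big_ord_recl big_ord0 /= /bump /= !add1n.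
  have wE : w = v^-1 + m%:C by rewrite /v invrK subrK.
  have XE : X x = x%:C - m%:C by rewrite /X rmorphB.
  have q : w - x%:C != 0 by exact: resolvent_neq0.
  have wx : w - x%:C = v^-1 - X x by rewrite wE XE; ring.
  rewrite /rem wx; rewrite wx in q.
  have q' : 1 - v * X x != 0.
    apply: contra q => /eqP h; apply/eqP.
    by rewrite -(mulKf v0 (X x)) (_ : v * X x = 1) ?mulr1 ?subrr//; apply/eqP;
      rewrite eq_sym -subr_eq0 h.
  move: (X x) q' => Z q'; field; rewrite v0 /=.
  by apply: contraNneq q' => h; apply/eqP; rewrite -h; ring.
exists (v ^+ 5 * complex_expectation mu rem); last first.
  rewrite normcM normcX mulrC; apply: ler_wpM2r.
    by rewrite exprn_ge0// normc_ge0.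
  have -> : (4 : R) = 2 * 2 by ring.
  apply: (complex_expectation_bound mD muD brem) => x Dx.
  have nX : normc (X x) <= 1 by rewrite normc_real; exact: Dm.
  rewrite /rem normcM normcX.
  apply: le_trans (_ : 1 * normc (v^-1 * (w - x%:C)^-1) <= _).
    by apply: ler_wpM2r; [exact: normc_ge0|exact/exprn_ile1/nX/normc_ge0].
  rewrite mul1r -invfM normcV -[leRHS]invrK lef_pV2 ?posrE ?invr_gt0//; last first.
    rewrite normcM mulr_gt0// lt_neqAle normc_ge0 andbT eq_sym; apply/eqP => /eq0_normc.
      by apply/eqP.
    by apply/eqP; exact: resolvent_neq0.
  have -> : v * (w - x%:C) = 1 - v * X x.
    have -> : w - x%:C = v^-1 - X x by rewrite /v invrK /X rmorphB; ring.
    by rewrite mulrBr mulfV.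
  have h : normc (1 : R[i]) <= normc (1 - v * X x) + normc (v * X x).
    by rewrite -{1}(subrK (v * X x) 1); exact: le_normcD.
  have : normc (v * X x) <= 1/2.
    by rewrite normcM -[leRHS]mulr1; apply: ler_pM => //; exact: normc_ge0.
  by move: h; rewrite normc1; lra.
have bs k : bounded_measurable D (fun x => v ^+ k.+1 * X x ^+ k).
  exact: bounded_measurableM.
rewrite cauchy_transformE E.
rewrite (complex_expectationD mD muD); last 2 first.
- by apply: bounded_measurable_sum => i; exact: bs.
- exact: bounded_measurableM.
rewrite (complex_expectationZ mD muD)//.
rewrite (complex_expectation_sum mD muD (index_enum 'I_5) (fun i : 'I_5 => bs i)).
under eq_bigr do rewrite (complex_expectationZ mD muD _ (bX _)) expectation_centeredX.
rewrite !big_ord_recl big_ord0 /= /bump /= !add1n.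
have -> : c 0 = 1.
  have := expectation_centeredX 0.
  under eq_fun do rewrite expr0.
  by rewrite complex_expectation_cst => -[].
by rewrite c1 /=; ring.
Qed.

(** At [W = z + phi_mu z] one has [G_mu W = 1/z]. With [u = 1/z] and [v = 1/(W - m)], the difference
    [1/v - 1/u] is exactly [psi = phi_mu z - m], so [cumulant_expansion] yields the expansion that
    [hankel_of_subordinate] asks for. *)
Lemma fid_hankel (n : nat) : (1 < n)%N -> freely_infinitely_divisible mu ->
  forall a b : R, 0 <= c 2 * a ^+ 2 + 2 * c 3 * a * b +
    (c 4 - 2 * c 2 ^+ 2 + n%:R^-1 * c 2 ^+ 2) * b ^+ 2.
Proof.
move=> n1 /(_ n (ltnW n1))[nu pw].
(* The last convolution step supplies transforms of both [mu] and [nu]. This is where [1 < n]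
   enters, a first power being a mere equality of measures. *)
have [phi [phin [tphi tphin]]] : exists phi phin : R -> R[i],
    axis_transform mu phi /\ axis_transform nu phin.
  move: n1; case: pw => // k rho mu' _ [a [b [p1 [p2 [p3 [[a0 _] _ v2 v3 _]]]]]] _.
  by do 2 eexists; split; [exact: voiculescu_axis a0 v3|exact: voiculescu_axis a0 v2].
have [Yn Hn] := axis_transform_power pw tphi tphin.
have r0 : 0 < n%:R^-1 :> R by rewrite invr_gt0 ltr0n (ltn_trans _ n1).
have apE (e : R) : axis_point e = 0 +i* e^-1 :> R[i].
  by rewrite /axis_point; apply/eqP; rewrite eq_complex /=;
    rewrite !(mul0r, mul1r, mulr0, subr0, add0r, addr0, oppr0, subrr) !eqxx.
pose f (e : R) := phi e^-1.
pose psi (e : R) : R[i] := f e - m%:C.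
pose W (e : R) : R[i] := axis_point e + f e.
have [H1 /(_ (1/2) ltac:(lra)) H2] := tphi.
have {}H1 := near0_large H1; have {}H2 := near0_large H2.
have [[Y3 H3] _] := tphin.
apply: (@hankel_of_subordinate _ nu _ _ _ m _ psi r0).
  have h3 : exists Y, forall y, Y < y -> phi y = phin y *+ n /\
     0 < complex.Im (0 +i* y + phin y) /\
      cauchy_transform nu (0 +i* y + phin y) = (0 +i* y)^-1.
    exists (Num.max Yn Y3) => y; rewrite gt_max => /andP[y1 y2].
    by split; [exact: Hn|exact: H3].
  apply: near0S (near0_large h3) => e e0 [pn].
  rewrite -!apE.
  have -> // : subordinate_point psi m n%:R^-1 e = axis_point e + phin e^-1.
  have rC : (n%:R^-1)%:C = n%:R^-1 :> R[i] by rewrite fmorphV rmorph_nat.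
  have rmC : (n%:R^-1 * m)%:C = n%:R^-1 * m%:C :> R[i] by rewrite -rC -rmorphM.
  rewrite /subordinate_point /psi /f pn -[phin _ *+ n]mulr_natl rmC rC.
  have nn : n%:R != 0 :> R[i] by rewrite pnatr_eq0 -lt0n (ltn_trans _ n1).
  by field.
pose v (e : R) := (W e - m%:C)^-1.
(* [|phi (iy)| <= y/2] keeps the imaginary part of [W] above [1/(2 e)]. *)
have Wv : near0 (fun e => 0 < complex.Im (W e) /\ normc (v e) <= 2 * e).
  have := near0I H1 H2; apply: near0S => e e0 [[i1 _] i2]; rewrite -apE in i1.
  split => //; apply: le_trans (normc_resolvent_le _ i1) _.
  rewrite -[leRHS]invrK lef_pV2 ?posrE ?invr_gt0 ?mulr_gt0//.
  rewrite /W cImD apE /= invfM.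
  have := le_trans (normr_Im_le _) i2; rewrite -/(f e) ler_norml => /andP[+ _].
  by lra.
have Ov : Oat0 1 v by exists 2; apply: near0S Wv => e _ [_]; rewrite expr1.
have uE (e : R) : 0 < e -> (axis_point e)^-1 = - 'i * e%:C.
  move=> e0; rewrite apE; apply/eqP; rewrite eq_complex /=.
  rewrite expr0n /= add0r !(mul0r, oppr0, mulr0, subr0, add0r, addr0) eqxx /= mulN1r.
  by apply/eqP; field; rewrite gt_eqF.
pose rho (e : R) := (axis_point e)^-1 / v e - 1 -
  ((c 2)%:C * v e ^+ 2 + (c 3)%:C * v e ^+ 3 + (c 4)%:C * v e ^+ 4).
have v0 : near0 (fun e => v e != 0).
  by apply: near0S Wv => e _ [i1 _]; rewrite invr_eq0; exact: resolvent_neq0.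
have Orho : Oat0 5 rho.
  exists (4 * 2 ^+ 5).
  have := near0I (near0I Wv v0) (near0I H1 (near0_lt (_ : 0 < 1/4)%R)).
  case; first by lra.
  move=> e1 e1p He; exists e1 => // e e0 /(He _ e0)[[[i1 nv] ve0] [[_ G1] e4]].
  rewrite -apE -/(W e) in G1.
  have vh : normc (v e) <= 1/2 by lra.
  have [rh Grh nrh] := cauchy_transform_expand i1 vh.
  have -> : rho e = rh.
    rewrite /rho -G1 Grh -/(v e).
    by rewrite mulrC mulKf//; ring.
  apply: le_trans nrh _; rewrite -mulrA ler_pM2l// -exprMn.
  by rewrite lerXn2r ?nnegrE ?normc_ge0// mulr_ge0// ltW.
have uv : near0 (fun e => (axis_point e)^-1 = v e * (1 + ((c 2)%:C * v e ^+ 2 +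
    (c 3)%:C * v e ^+ 3 + (c 4)%:C * v e ^+ 4 + rho e))).
  apply: near0S v0 => e _; rewrite /rho.
  by move: (v e) ((axis_point e)^-1) => V U V0; field.
have := cumulant_expansion Ov Orho uv v0 (near0S (fun e e0 _ => uE e e0) (near0_lt ltr01)).
apply: Oat0_near; apply: near0S (near0_lt ltr01) => e e0 _.
rewrite /cumulant_remainder -uE// invrK /v invrK /W /psi.
by congr (_ - _); ring.
Qed.

End free_infinite_divisibility.

(** * Moments of the beta distribution *)

Section euler_beta.
Variable R : realType.
Implicit Types p q x : R.
Local Notation leb := (@lebesgue_measure R).
Local Notation I01 := (`]0%R, 1%R[%classic : set (measurableTypeR R)).

Lemma beta_kernel_integrable p q : 0 < p -> 0 < q ->
  leb.-integrable I01 (EFin \o beta_kernel p q).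
Proof.
move=> p0 q0; apply/integrableP; split.
  by apply: measurable_funTS; apply/measurable_EFinP; exact: measurable_beta_kernel.
apply: le_lt_trans (integral_beta_kernel_lty p0 q0).
rewrite le_eqVlt; apply/orP; left; apply/eqP; apply: eq_integral => x _ /=.
by rewrite ger0_norm// beta_kernel_ge0.
Qed.

Lemma is_derive_onem_powR q x : x < 1 ->
  is_derive (x : R) 1 (fun x => (1 - x) `^ q) (- (q * (1 - x) `^ (q - 1))).
Proof.
move=> x1; have x0 : 0 < 1 - x by rewrite subr_gt0.
have dp := is_derive1_powR q x0.
have d1 : is_derive (x : R) (1 : R) (fun y : R => 1 - y) (0 - 1).
  exact: (is_deriveB (is_derive_cst (1 : R) x 1) (is_derive_id x 1)).
have dd := @is_derive1_comp _ (@powR R ^~ q) (fun y : R => 1 - y) x _ _ dp d1.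
by apply: (is_derive_eq dd); rewrite sub0r mulrN1.
Qed.

Lemma continuous_beta_kernel p q x : 0 < x -> x < 1 ->
  {for x, continuous (beta_kernel p q)}.
Proof.
move=> x0 x1.
have c1 : {for x, continuous (fun y : R => y `^ (p - 1))}.
  apply/differentiable_continuous/derivable1_diffP.
  exact: (@ex_derive _ _ _ _ _ _ _ (is_derive1_powR _ x0)).
have c2 : {for x, continuous (fun y : R => (1 - y) `^ (q - 1))}.
  apply/differentiable_continuous/derivable1_diffP.
  exact: (@ex_derive _ _ _ _ _ _ _ (is_derive_onem_powR _ x1)).
exact: cvgM c1 c2.
Qed.

(** The shift by 3 gives [a n < 1/2], so that [[a n, 1 - a n]] is never degenerate. *)
Let a (n : nat) : R := n.+3%:R^-1.
Let F (n : nat) : set (measurableTypeR R) := `[a n, 1 - a n]%classic.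

Let a0 n : 0 < a n. Proof. by rewrite invr_gt0. Qed.

Let a2 n : a n < 1 / 2.
Proof. by rewrite div1r ltf_pV2 ?posrE// ltr_nat. Qed.

Let F01 n : F n `<=` I01.
Proof.
move=> x; rewrite /F /= !in_itv /= => /andP[h1 h2].
rewrite (lt_le_trans (a0 n) h1) /=; apply: le_lt_trans h2 _.
by rewrite gtrBl.
Qed.

Let cupF : \bigcup_n F n = I01.
Proof.
apply/seteqP; split=> [x [n _]|x]; first exact: F01.
rewrite /= in_itv /= => /andP[x0 x1].
have y0 : 0 < Num.min x (1 - x) by rewrite lt_min x0 subr_gt0.
exists (Num.trunc (Num.min x (1 - x))^-1) => //.
set k := Num.trunc _; have ak : a k <= Num.min x (1 - x).
  rewrite /a invf_ple ?posrE// (le_trans (ltW (truncnS_gt _)))// ler_nat -/k.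
  exact: leq_trans (leqnSn _) (leqnSn _).
move: ak; rewrite le_min /F /= in_itv /= => /andP[-> h].
lra.
Qed.

Lemma euler_beta_cvg p q : 0 < p -> 0 < q ->
  \int[leb]_(x in F n) beta_kernel p q x @[n --> \oo] --> euler_beta p q.
Proof.
move=> p0 q0; apply: fine_cvg; rewrite EFin_euler_beta// -cupF.
apply: ge0_nondecreasing_set_cvg_integral => //.
- move=> m n mn; apply/subsetPset => x; rewrite /F /= !in_itv /= => /andP[h1 h2].
  have nm : a n <= a m by rewrite lef_pV2 ?posrE// ler_nat !ltnS.
  by apply/andP; split; lra.
- by move=> n; exact: measurable_itv.
- by move=> n; apply: measurable_funTS; apply/measurable_EFinP; exact: measurable_beta_kernel.
- by move=> n x _; rewrite lee_fin beta_kernel_ge0.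
Qed.

(** The fundamental theorem of calculus for [x^p (1 - x)^q]. The endpoints are cut off because the
    derivative may be unbounded there. *)
Lemma beta_kernel_by_parts p q n : 0 < p -> 0 < q ->
  p * \int[leb]_(x in F n) beta_kernel p (q + 1) x -
  q * \int[leb]_(x in F n) beta_kernel (p + 1) q x =
  (1 - a n) `^ p * a n `^ q - a n `^ p * (1 - a n) `^ q.
Proof.
move=> p0 q0.
have p1 : 0 < p + 1 by rewrite addr_gt0.
have q1 : 0 < q + 1 by rewrite addr_gt0.
have an := a0 n; have an2 := a2 n.
have iF (g : R -> R) : leb.-integrable I01 (EFin \o g) -> leb.-integrable (F n) (EFin \o g).
  by apply: integrableS => //; exact: measurable_itv.
have i1 := iF _ (beta_kernel_integrable p0 q1).
have i2 := iF _ (beta_kernel_integrable p1 q0).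
have mF : measurable (F n) by exact: measurable_itv.
rewrite -!RintegralZl// -RintegralB//; last 2 first.
- exact: (integrableZl mF p i1).
- exact: (integrableZl mF q i2).
pose f x := p * beta_kernel p (q + 1) x - q * beta_kernel (p + 1) q x.
pose H x : R := x `^ p * (1 - x) `^ q.
have dH x : 0 < x -> x < 1 -> is_derive x 1 H (f x).
  move=> x0 x1.
  have := is_deriveM (is_derive1_powR p x0) (is_derive_onem_powR q x1).
  move=> dd; apply: (is_derive_eq dd).
  by rewrite /f /beta_kernel !addrK /GRing.scale /=; ring.
have itv x : a n <= x <= 1 - a n -> 0 < x /\ x < 1.
  by move=> /andP[h1 h2]; split; lra.
have cH x : a n <= x <= 1 - a n -> {for x, continuous H}.
  move=> /itv[x0 x1]; apply/differentiable_continuous/derivable1_diffP.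
  exact: (@ex_derive _ _ _ _ _ _ _ (dH x x0 x1)).
rewrite /Rintegral (@continuous_FTC2 _ f H).
- by rewrite -EFinB /= /H subKr.
- lra.
- apply: continuous_in_subspaceT => x; rewrite inE /= in_itv /= => /itv[x0 x1].
  by apply: cvgB; apply: cvgM; [exact: cvg_cst|exact: continuous_beta_kernel|
    exact: cvg_cst|exact: continuous_beta_kernel].
- split.
  + move=> x; rewrite in_itv /= => /andP[/ltW ax /ltW xb].
    have [x0 x1] : 0 < x /\ x < 1 by apply: itv; rewrite ax xb.
    exact: (@ex_derive _ _ _ _ _ _ _ (dH x x0 x1)).
  + by apply: cvg_at_right_filter; apply: cH; apply/andP; split; lra.
  + by apply: cvg_at_left_filter; apply: cH; apply/andP; split; lra.
- move=> x; rewrite in_itv /= => /andP[/ltW ax /ltW xb].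
  have [x0 x1] : 0 < x /\ x < 1 by apply: itv; rewrite ax xb.
  by rewrite derive1E; apply: (@derive_val _ _ _ _ _ _ _ (dH x x0 x1)).
Qed.

Let cvg_a_powR p : 0 < p -> a n `^ p @[n --> \oo] --> (0 : R).
Proof.
move=> p0; have ca : a n @[n --> \oo] --> (0 : R).
  have := @cvg_harmonic R; rewrite -(@cvg_shiftn 2 _ (@harmonic R)).
  by apply: cvg_trans; apply: near_eq_cvg; apply: nearW => n; rewrite /a /= addn2.
apply: (@cvg_at_rightP _ (fun x : R => x `^ p) 0 0).1; first exact: powR_cvg0.
by split.
Qed.

(** The limit of the integration by parts: the boundary terms are trapped between [- a n ^ p] and
    [a n ^ q], hence vanish. *)
Lemma euler_beta_swap p q : 0 < p -> 0 < q ->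
  p * euler_beta p (q + 1) = q * euler_beta (p + 1) q.
Proof.
move=> p0 q0; apply/eqP; rewrite -subr_eq0; apply/eqP.
have p1 : 0 < p + 1 by rewrite addr_gt0.
have q1 : 0 < q + 1 by rewrite addr_gt0.
have c1 : p * (\int[leb]_(x in F n) beta_kernel p (q + 1) x) -
    q * (\int[leb]_(x in F n) beta_kernel (p + 1) q x) @[n --> \oo] -->
    p * euler_beta p (q + 1) - q * euler_beta (p + 1) q.
  by apply: cvgB; apply: cvgMl_tmp; exact: euler_beta_cvg.
have bound x r : 0 < x -> x <= 1 -> 0 < r -> x `^ r <= 1.
  move=> x0 x1 r0; have := @ge0_ler_powR _ r (ltW r0) x 1.
  by rewrite powR1; apply => //; rewrite nnegrE ltW.
have c2 : (1 - a n) `^ p * a n `^ q - a n `^ p * (1 - a n) `^ q @[n --> \oo] --> (0 : R).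
  apply: (@squeeze_cvgr _ _ _ _ (fun n => - a n `^ p) (fun n => a n `^ q)).
  - apply: nearW => n; have h := a0 n; have h2 := a2 n.
    have e1 : 0 <= (1 - a n) `^ p * a n `^ q by rewrite mulr_ge0 ?powR_ge0.
    have e2 : 0 <= a n `^ p * (1 - a n) `^ q by rewrite mulr_ge0 ?powR_ge0.
    have e3 : (1 - a n) `^ p * a n `^ q <= a n `^ q.
      by rewrite ler_piMl ?powR_ge0// bound//; lra.
    have e4 : a n `^ p * (1 - a n) `^ q <= a n `^ p.
      by rewrite ler_piMr ?powR_ge0// bound//; lra.
    by apply/andP; split; lra.
  - by rewrite -oppr0; apply: cvgN; exact: cvg_a_powR.
  - exact: cvg_a_powR.
rewrite (funext (fun n => beta_kernel_by_parts n p0 q0)) in c1.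
exact: (cvg_unique _ c1 c2).
Qed.

(** Splitting [1 = x + (1 - x)] under the integral gives [B(p, q) = B(p, q + 1) + B(p + 1, q)], and
    [euler_beta_swap] eliminates [B(p, q + 1)]. *)
Lemma euler_betaS p q : 0 < p -> 0 < q ->
  euler_beta (p + 1) q = p / (p + q) * euler_beta p q.
Proof.
move=> p0 q0; have sw := euler_beta_swap p0 q0.
have p1 : 0 < p + 1 by rewrite addr_gt0.
have q1 : 0 < q + 1 by rewrite addr_gt0.
have add : euler_beta p q = euler_beta p (q + 1) + euler_beta (p + 1) q.
  rewrite /euler_beta -RintegralD//; try exact: beta_kernel_integrable.
  apply: eq_Rintegral => x; rewrite inE /= in_itv /= => /andP[x0 x1].
  have y0 : 0 < 1 - x by lra.
  rewrite /beta_kernel !addrK.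
  rewrite -[in X in _ = X + _](mulr_powRB1 (ltW y0) q0) -(mulr_powRB1 (ltW x0) p0).
  by ring.
have s0 : p + q != 0 by rewrite gt_eqF// addr_gt0.
apply: (@mulfI _ (p + q)) => //.
transitivity (p * euler_beta p q); last by field.
by rewrite add mulrDr sw -mulrDl addrC.
Qed.

End euler_beta.

Section beta_moments.
Variables (R : realType) (p q : {posnum R}).
Local Notation leb := (@lebesgue_measure R).
Local Notation I01 := (`]0%R, 1%R[%classic : set (measurableTypeR R)).
Local Notation beta := (beta_distribution p q : probability (measurableTypeR R) R).
Local Notation B := (euler_beta p%:num q%:num).

Let B0 : 0 < B. Proof. exact: euler_beta_gt0. Qed.

Lemma beta_distribution01 : beta I01 = 1%E.
Proof.
rewrite -(probability_setT beta) /= /beta_distribution.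
rewrite [LHS]integral_mkcond; apply: eq_integral => x _.
rewrite patchE /beta_density mem_setE; case: ifP => // h.
by rewrite h.
Qed.

Lemma beta_distribution_dom : beta `<< leb.
Proof.
apply/null_content_dominatesP => A mA A0; rewrite /= /beta_distribution.
apply: null_set_integral => //.
by apply/measurable_funTS/measurable_EFinP; exact: measurable_beta_density.
Qed.

(** The density agrees almost everywhere with the Radon-Nikodym derivative, both having the same
    integral over every measurable set; the change of variables then applies. *)
Lemma integral_beta_distribution (f : R -> R) (M : R) :
  measurable_fun [set: measurableTypeR R] f -> (forall x, I01 x -> `|f x| <= M) ->
  \int[beta]_x f x = \int[leb]_(x in I01) (f x * beta_kernel p%:num q%:num x) / B.
Proof.
move=> mf fM.
have mI : measurable I01 by exact: measurable_itv.
have intf := integrable_of_bounded mI beta_distribution01 mf fM.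
have E : (\int[beta]_x (f x)%:E =
    \int[leb]_x ((f x)%:E * (beta_density p%:num q%:num x)%:E))%E.
  rewrite -(Radon_Nikodym_change_of_variables beta_distribution_dom)//=.
  apply: ae_eq_integral => //.
  - apply: emeasurable_funM => //; first exact/measurable_EFinP.
    apply: (measurable_int leb).
    by apply: Radon_Nikodym_integrable; exact: beta_distribution_dom.
  - apply: emeasurable_funM => //; apply/measurable_EFinP => //.
    exact: measurable_beta_density.
  - apply: ae_eqe_mul2l => /=.
    rewrite Radon_NikodymE//=; first exact: beta_distribution_dom.
    move=> dom; case: cid => /= h [h1 h2 h3].
    apply: integral_ae_eq => //=.
    + by apply/measurable_EFinP; exact: measurable_beta_density.
    + by move=> A _ mA; rewrite -h3.
rewrite /Rintegral E.
have -> : (\int[leb]_x ((f x)%:E * (beta_density p%:num q%:num x)%:E) =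
    \int[leb]_(x in I01) (B^-1 * (f x * beta_kernel p%:num q%:num x))%:E)%E.
  rewrite [RHS]integral_mkcond; apply: eq_integral => x _.
  rewrite patchE /beta_density mem_setE; case: ifP => h; last by rewrite mule0.
  by rewrite -EFinM; congr (_%:E); ring.
rewrite mulrC -RintegralZl//.
apply: (@le_integrable _ _ _ leb _ mI _ (fun x => (`|M| * beta_kernel p%:num q%:num x)%:E)).
- apply: measurable_funTS; apply/measurable_EFinP; apply: measurable_funM => //.
  exact: measurable_beta_kernel.
- move=> x Ix /=; rewrite lee_fin (normrM (f x)) (normrM `|M|) normr_id
    (ger0_norm (beta_kernel_ge0 _ _ _)).
  by rewrite ler_wpM2r ?beta_kernel_ge0// (le_trans (fM x Ix))// ler_norm.
- exact: (integrableZl mI `|M| (beta_kernel_integrable _ _)).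
Qed.

Lemma bounded01_expr (n : nat) (x : R) : I01 x -> `|x ^+ n| <= 1.
Proof.
rewrite /= in_itv /= => /andP[/ltW x0 /ltW x1]; rewrite ger0_norm ?exprn_ge0//.
exact: exprn_ile1.
Qed.

Lemma moment_beta (n : nat) : moment beta n = euler_beta (p%:num + n%:R) q%:num / B.
Proof.
rewrite /moment (@integral_beta_distribution _ 1); last exact: bounded01_expr.
  congr (_ / _); apply: eq_Rintegral => x; rewrite inE /= in_itv /= => /andP[x0 x1].
  rewrite /beta_kernel mulrA; congr (_ * _).
  have -> : p%:num + n%:R - 1 = n%:R + (p%:num - 1) by ring.
  by rewrite (@powRD _ x n%:R) ?(gt_eqF x0) ?implybT// powR_mulrn// ltW.
exact: measurable_funX.
Qed.

Lemma moment_beta0 : moment beta 0 = 1.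
Proof. by rewrite moment_beta addr0 mulfV// gt_eqF. Qed.

Lemma moment_betaS (n : nat) : moment beta n.+1 =
  (p%:num + n%:R) / (p%:num + n%:R + q%:num) * moment beta n.
Proof.
rewrite !moment_beta -addn1 natrD addrA euler_betaS ?mulrA//.
Qed.

End beta_moments.

(** * Sums over noncrossing partitions *)

Section noncrossing_codes.
Local Open Scope nat_scope.
Implicit Types (t : seq nat) (n : nat).

(** All lists with [t_i <= i], a weaker condition than the usual one on restricted growth strings.
    They are candidates that can be enumerated by computation and filtered afterwards. *)
Fixpoint restricted_growth n : seq (seq nat) :=
  if n is n'.+1 then
    [seq rcons t j | t <- restricted_growth n', j <- iota 0 n]
  else [:: [::]].

Lemma mem_restricted_growth n t : (t \in restricted_growth n) =
  (size t == n) && all (fun i => nth 0 t i <= i) (iota 0 n).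
Proof.
elim: n t => [|n IH] t; first by rewrite inE andbT size_eq0.
case/lastP: t => [|t j].
  rewrite andFb; apply/negbTE/allpairsP => -[[s j] [_ _]].
  by move/(congr1 size); rewrite size_rcons.
have iS : iota 0 n.+1 = rcons (iota 0 n) n by rewrite -addn1 iotaD cats1.
have -> : restricted_growth n.+1 =
  [seq rcons t j | t <- restricted_growth n, j <- iota 0 n.+1] by [].
rewrite size_rcons eqSS [in X in _ = X]iS all_rcons.
apply/allpairsP/idP => [[[s k] [sn kn /rcons_inj[-> ->]]]|/and3P[/eqP tn tj al]].
  move: kn; rewrite mem_iota add0n => /= kn.
  move: sn; rewrite IH => /andP[/eqP sn al]; rewrite sn eqxx /=; apply/andP; split.
    by rewrite nth_rcons sn ltnn eqxx -ltnS.
  apply/allP => i; rewrite mem_iota add0n => /= ni.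
  by rewrite nth_rcons sn ni; apply: (allP al); rewrite mem_iota add0n.
exists (t, j); split => //.
  rewrite IH tn eqxx /=; apply/allP => i ii; have := allP al _ ii.
  by rewrite mem_iota add0n /= in ii; rewrite nth_rcons tn ii.
rewrite mem_iota add0n /=.
by move: tj; rewrite nth_rcons tn ltnn eqxx.
Qed.

(** Together with [t_i <= i], idempotence makes [t_i] the least point of the class of [i]. *)
Definition idempotent_code t : bool :=
  all (fun i => nth 0 t (nth 0 t i) == nth 0 t i) (iota 0 (size t)).

Definition noncrossing_code t : bool :=
  let r := iota 0 (size t) in
  all (fun a => all (fun b => all (fun c => all (fun d =>
    [&& a < b, b < c, c < d, nth 0 t a == nth 0 t c & nth 0 t b == nth 0 t d] ==>
      (nth 0 t a == nth 0 t b)) r) r) r) r.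

(* A noncrossing partition is encoded by the list sending each point to the least
   element of its block. *)
Definition NC_codes n : seq (seq nat) :=
  [seq t <- restricted_growth n | idempotent_code t && noncrossing_code t].

Definition code_partition n t : {set {set 'I_n}} :=
  [set [set j : 'I_n | nth 0 t j == i] | i : 'I_n & nth 0 t i == i]%SET.

Section one_code.
Variables (n : nat) (t : seq nat).
Hypothesis tn : t \in NC_codes n.

Lemma size_code : size t = n.
Proof.
by move: tn; rewrite mem_filter mem_restricted_growth => /andP[_ /andP[/eqP]].
Qed.

Lemma code_le i : i < n -> nth 0 t i <= i.
Proof.
move: tn; rewrite mem_filter mem_restricted_growth => /andP[_ /andP[_ /allP al]] ni.
by apply: al; rewrite mem_iota.
Qed.

Lemma code_idem i : i < n -> nth 0 t (nth 0 t i) = nth 0 t i.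
Proof.
move: tn; rewrite mem_filter => /andP[/andP[/allP al _] _] ni.
by apply/eqP/al; rewrite mem_iota size_code.
Qed.

Lemma code_lt (i : 'I_n) : nth 0 t i < n.
Proof. exact: leq_ltn_trans (code_le (ltn_ord i)) (ltn_ord i). Qed.

Lemma mem_code_partition (V : {set 'I_n}) : V \in code_partition n t ->
  exists2 i : 'I_n, nth 0 t i = i & V = [set j : 'I_n | nth 0 t j == i]%SET.
Proof. by move=> /finset.imsetP[k]; rewrite inE => /eqP tk ->; exists k. Qed.

Lemma code_block (i : 'I_n) : [set j : 'I_n | nth 0 t j == nth 0 t i]%SET \in code_partition n t.
Proof.
apply/finset.imsetP; exists (Ordinal (code_lt i)) => //.
by rewrite inE /= code_idem.
Qed.

Lemma code_partition_NC : code_partition n t \in NC n.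
Proof.
rewrite inE; apply/andP; split.
  apply/and3P; split.
  - apply/eqP/finset.setP => j; rewrite inE; apply/finset.bigcupP.
    by exists [set k : 'I_n | nth 0 t k == nth 0 t j]%SET; [exact: code_block|rewrite inE].
  - apply/finset.trivIsetP => _ _ /mem_code_partition[i _ ->] /mem_code_partition[i' _ ->] ne.
    rewrite -finset.setI_eq0; apply/eqP/finset.setP => j; rewrite !inE.
    apply/negP => /andP[/eqP -> /eqP ii']; move/eqP: ne; apply.
    by rewrite ii'.
  - apply/negP => /mem_code_partition[i ti /finset.setP/(_ i)].
    by rewrite !inE ti eqxx.
apply/forall_inP => _ /mem_code_partition[i _ ->].
apply/forall_inP => _ /mem_code_partition[i' _ ->].
apply/implyP => ne; apply/negP => /exists_inP[a]; rewrite inE => /eqP ta.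
move=> /exists_inP[b]; rewrite inE => /eqP tb /exists_inP[c]; rewrite inE => /eqP tc.
move=> /exists_inP[d]; rewrite inE => /eqP td /and3P[ab bc cd].
move: tn; rewrite mem_filter => /andP[/andP[_ nc] _].
have io (k : 'I_n) : (k : nat) \in iota 0 (size t) by rewrite mem_iota size_code /=.
have := allP (allP (allP (allP nc _ (io a)) _ (io b)) _ (io c)) _ (io d).
rewrite ab bc cd ta tb tc td !eqxx /= => /eqP ii'.
by move: ne; rewrite (val_inj ii') eqxx.
Qed.

Lemma card_code_block i : #|[set j : 'I_n | nth 0 t j == i]%SET| = count_mem i t.
Proof.
rewrite -sum1_card -sum1_count (big_nth 0) big_mkord size_code.
by apply: eq_bigl => j; rewrite inE.
Qed.

End one_code.

(** The least element of a block depends on the block alone; the inequality [le] is used in both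
    directions. *)
Lemma code_partition_inj n : {in NC_codes n &, injective (code_partition n)}.
Proof.
have le s t (i : 'I_n) : s \in NC_codes n -> t \in NC_codes n ->
    code_partition n s = code_partition n t -> nth 0 s i <= nth 0 t i.
  move=> hs ht st.
  have := code_block ht i; rewrite -st => /mem_code_partition[k sk E].
  have : (i \in [set j : 'I_n | nth 0 t j == nth 0 t i])%SET by rewrite inE.
  rewrite E inE => /eqP si.
  have : (Ordinal (code_lt ht i) \in [set j : 'I_n | nth 0 t j == nth 0 t i]%SET).
    by rewrite inE /= (code_idem ht).
  rewrite E inE /= => /eqP s2.
  by rewrite si -s2 (code_le hs)// (code_lt ht).
move=> s t hs ht st; apply: (@eq_from_nth _ 0); first by rewrite !(size_code hs, size_code ht).
move=> i; rewrite (size_code hs) => ni.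
by apply/eqP; rewrite eqn_leq (le s t (Ordinal ni) hs ht st) (le t s (Ordinal ni) ht hs (esym st)).
Qed.

Section code_of_partition.
Variables (n : nat) (P : {set {set 'I_n}}).
Hypothesis PNC : P \in NC n.

Definition least_in_block (i : 'I_n) : 'I_n := [arg min_(j < i | j \in finset.pblock P i) j].
Definition code_of_partition : seq nat := [seq val (least_in_block i) | i <- enum 'I_n].
Local Notation t := code_of_partition.

Let partP : finset.partition P [set: 'I_n]%SET.
Proof. by move: PNC; rewrite inE => /andP[]. Qed.

Let trivP : finset.trivIset P. Proof. by case/and3P: partP. Qed.

Let coverP i : i \in finset.cover P.
Proof. by case/and3P: partP => /eqP ->; rewrite inE. Qed.

Let memP i : i \in finset.pblock P i. Proof. by rewrite finset.mem_pblock. Qed.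

Let leastP i : least_in_block i \in finset.pblock P i /\
  forall j, j \in finset.pblock P i -> least_in_block i <= j.
Proof. by rewrite /least_in_block; case: arg_minnP => // j jP le; split. Qed.

Let nthE (i : 'I_n) : nth 0 t i = least_in_block i.
Proof. by rewrite (nth_map i) ?size_enum_ord// nth_ord_enum. Qed.

Let least_eq i j :
  (least_in_block i == least_in_block j :> nat) =
  (finset.pblock P i == finset.pblock P j).
Proof.
apply/eqP/eqP => [/val_inj ij|ij].
  have [h _] := leastP i; have [h' _] := leastP j.
  by rewrite -(finset.same_pblock trivP h) -(finset.same_pblock trivP h') ij.
have [h l] := leastP i; have [h' l'] := leastP j.
by apply/eqP; rewrite eqn_leq l ?l' -?ij// ij.
Qed.

Let least_idem i : least_in_block (least_in_block i) = least_in_block i.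
Proof.
apply/val_inj/eqP; rewrite least_eq; apply/eqP; have [h _] := leastP i.
exact: (finset.same_pblock trivP h).
Qed.

Lemma code_of_partition_mem : t \in NC_codes n.
Proof.
have st : size t = n by rewrite size_map size_enum_ord.
rewrite mem_filter mem_restricted_growth st eqxx /=.
rewrite /idempotent_code /noncrossing_code st.
apply/andP; split; last first.
  apply/allP => i; rewrite mem_iota add0n /= => ni.
  by rewrite (nthE (Ordinal ni)); exact: ((leastP (Ordinal ni)).2 _ (memP _)).
apply/andP; split.
  apply/allP => i; rewrite mem_iota add0n /= => ni.
  by rewrite (nthE (Ordinal ni)) nthE least_idem.
apply/allP => a; rewrite mem_iota add0n /= => na.
apply/allP => b; rewrite mem_iota add0n /= => nb.
apply/allP => c; rewrite mem_iota add0n /= => nc.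
apply/allP => d; rewrite mem_iota add0n /= => nd.
rewrite (nthE (Ordinal na)) (nthE (Ordinal nb)) (nthE (Ordinal nc)) (nthE (Ordinal nd)).
rewrite !least_eq; apply/implyP => /and5P[ab bc cd /eqP ac /eqP bd].
apply: contraT => ne.
move: PNC; rewrite inE => /andP[_ /forall_inP nx].
have := nx _ (finset.pblock_mem (coverP (Ordinal na))) => /forall_inP.
move=> /(_ _ (finset.pblock_mem (coverP (Ordinal nb)))); rewrite ne /= => /negP; case.
apply/exists_inP; exists (Ordinal na); first exact: memP.
apply/exists_inP; exists (Ordinal nb); first exact: memP.
apply/exists_inP; exists (Ordinal nc); first by rewrite ac memP.
apply/exists_inP; exists (Ordinal nd); first by rewrite bd memP.
by rewrite /= ab bc cd.
Qed.

Lemma code_of_partitionK : code_partition n t = P.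
Proof.
have bl i : [set j : 'I_n | nth 0 t j == least_in_block i]%SET = finset.pblock P i.
  apply/finset.setP => j; rewrite inE nthE least_eq.
  apply/eqP/idP => [<-|ji]; first exact: memP.
  by rewrite (finset.same_pblock trivP ji).
apply/finset.setP => V; apply/finset.imsetP/idP => [[i +]|VP].
  rewrite inE nthE => /eqP li ->; rewrite -[in X in X \in _]li bl.
  exact/finset.pblock_mem/coverP.
have [i iV] : exists i, i \in V.
  by apply/finset.set0Pn; apply: contraTneq VP => ->; case/and3P: partP.
exists (least_in_block i); first by rewrite inE nthE least_idem.
by rewrite bl (finset.def_pblock trivP VP iV).
Qed.

End code_of_partition.

Lemma uniq_restricted_growth n : uniq (restricted_growth n).
Proof.
elim: n => // n IH; apply: allpairs_uniq => //; first exact: iota_uniq.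
by move=> [s i] [s' i'] _ _ /= /rcons_inj[-> ->].
Qed.

Lemma perm_NC_codes n : perm_eq (enum (NC n)) (map (code_partition n) (NC_codes n)).
Proof.
apply: uniq_perm; first exact: enum_uniq.
  rewrite map_inj_in_uniq; last exact: code_partition_inj.
  exact/filter_uniq/uniq_restricted_growth.
move=> P; rewrite mem_enum; apply/idP/mapP => [PN|[t tn ->]].
  by exists (code_of_partition P); [exact: code_of_partition_mem|rewrite code_of_partitionK].
exact: code_partition_NC.
Qed.

End noncrossing_codes.

Section noncrossing_sums.
Variable R : realType.
Implicit Types (m k : nat -> R).

(** Replaces a sum over sets of sets by one over a list that [vm_compute] evaluates. Blocks are
    indexed by their least points, the fixed points of the code, and block sizes become
    multiplicities. *)
Lemma sum_NC_codes (n : nat) k :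
  \sum_(P in NC n) \prod_(V in P) k #|V| =
  \sum_(t <- NC_codes n) \prod_(i <- iota 0 n | nth 0%N t i == i) k (count_mem i t).
Proof.
rewrite -big_enum (perm_big _ (perm_NC_codes n)) big_map.
rewrite [LHS]big_seq [RHS]big_seq; apply: eq_bigr => t tn.
have -> : iota 0 n = index_iota 0 n by rewrite /index_iota subn0.
rewrite big_mkord /code_partition big_imset /=; last first.
  move=> i i'; rewrite !inE => /eqP ti /eqP ti' /finset.setP/(_ i); rewrite !inE ti eqxx.
  by move/esym/eqP/val_inj.
by apply: eq_big => i; [rewrite inE|rewrite card_code_block].
Qed.

Lemma free_cumulant1 m : free_cumulant_of_moments m 1 = m 1%N.
Proof.
rewrite (moment_cumulant m) // sum_NC_codes.
have -> : NC_codes 1 = [:: [:: 0%N]] by vm_compute.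
by rewrite !(big_cons, big_nil) /= mulr1 addr0.
Qed.

Lemma free_cumulant2 m : free_cumulant_of_moments m 2 = m 2%N - m 1%N ^+ 2.
Proof.
have := moment_cumulant m (isT : 0 < 2)%N; rewrite sum_NC_codes -free_cumulant1.
have -> : NC_codes 2 = [:: [:: 0%N; 0%N]; [:: 0%N; 1%N]] by vm_compute.
by rewrite !(big_cons, big_nil) /= => ->; ring.
Qed.

Lemma free_cumulant3 m : free_cumulant_of_moments m 3 =
  m 3%N - 3 * m 2%N * m 1%N + 2 * m 1%N ^+ 3.
Proof.
have := moment_cumulant m (isT : 0 < 3)%N; rewrite sum_NC_codes.
set s := NC_codes 3.
have -> : s = ltac:(let v := eval vm_compute in (NC_codes 3) in exact v) by vm_compute.
rewrite !(big_cons, big_nil) /= => ->; rewrite free_cumulant2 free_cumulant1; ring.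
Qed.

Lemma free_cumulant4 m : free_cumulant_of_moments m 4 =
  m 4%N - 4 * m 3%N * m 1%N - 2 * m 2%N ^+ 2 + 10 * m 2%N * m 1%N ^+ 2 - 5 * m 1%N ^+ 4.
Proof.
have := moment_cumulant m (isT : 0 < 4)%N; rewrite sum_NC_codes.
set s := NC_codes 4.
(* Fourteen codes: every partition of four points except [{0, 2}, {1, 3}]. *)
have -> : s = ltac:(let v := eval vm_compute in (NC_codes 4) in exact v) by vm_compute.
rewrite !(big_cons, big_nil) /= => ->.
rewrite free_cumulant3 free_cumulant2 free_cumulant1; ring.
Qed.

End noncrossing_sums.

(** * The distribution with p = 41/50 and q = 32/25 *)

Lemma central_moment_binomial (R : realType) (mu : probability (measurableTypeR R) R)
    (D : set (measurableTypeR R)) (m : R) (k : nat) :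
  measurable D -> mu D = 1%E -> (forall x : R, D x -> `|x| <= 1) ->
  central_moment mu m k =
  \sum_(i < k.+1) (- m) ^+ i *+ 'C(k, i) * moment mu (k - i).
Proof.
move=> mD muD D1; apply: (@complexI R).
have bx : bounded_measurable D (fun x : R => x%:C).
  exact: (@bounded_measurable_real _ _ _ 1).
have Ex j : complex_expectation mu (fun x => x%:C ^+ j) = (moment mu j)%:C.
  rewrite -complex_expectation_real; congr (complex_expectation mu _).
  by apply/funext => x; rewrite rmorphXn.
rewrite -expectation_centeredX.
have -> : (fun x : R => (x - m)%:C ^+ k) = fun x : R =>
    \sum_(i < k.+1) (((- m) ^+ i *+ 'C(k, i))%:C * x%:C ^+ (k - i)).
  apply/funext => x; rewrite rmorphB exprDn; apply: eq_bigr => i _.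
  by rewrite rmorphMn rmorphXn rmorphN mulrnAl mulrC.
have bi i : bounded_measurable D (fun x : R =>
    ((- m) ^+ i *+ 'C(k, i))%:C * x%:C ^+ (k - i)).
  by apply: bounded_measurableM; [exact: bounded_measurable_cst|exact: bounded_measurableX].
rewrite (complex_expectation_sum mD muD (index_enum 'I_k.+1) (fun i : 'I_k.+1 => bi i)).
rewrite rmorph_sum; apply: eq_bigr => i _.
by rewrite (complex_expectationZ mD muD _ (bounded_measurableX _ bx)) Ex rmorphM.
Qed.

Lemma central_moments_le4 (R : realType) (mu : probability (measurableTypeR R) R)
    (D : set (measurableTypeR R)) (M := moment mu) (c := central_moment mu (M 1%N)) :
  measurable D -> mu D = 1%E -> (forall x : R, D x -> `|x| <= 1) ->
  [/\ c 1%N = 0, c 2 = M 2 - M 1%N ^+ 2,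
      c 3 = M 3 - 3 * M 1%N * M 2 + 2 * M 1%N ^+ 3 &
      c 4 = M 4 - 4 * M 1%N * M 3 + 6 * M 1%N ^+ 2 * M 2 - 3 * M 1%N ^+ 4].
Proof.
move=> mD muD D1.
have M0 : M 0%N = 1.
  apply: (@complexI R); rewrite /M /moment -complex_expectation_real.
  by under eq_fun do rewrite expr0; exact: complex_expectation_cst.
have b42 : 'C(4, 2) = 6%N by [].
have b43 : 'C(4, 3) = 4%N by [].
have b32 : 'C(3, 2) = 3%N by [].
have cb k : c k = _ := central_moment_binomial (M 1%N) k mD muD D1.
by split; rewrite cb !big_ord_recl big_ord0 /= /bump /= !add1n ?subSS ?subn0
  ?(bin0, bin1, binn) ?b42 ?b43 ?b32 -/M ?M0; ring.
Qed.

Section example.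
Variables (R : realType) (p q : {posnum R}).
Hypotheses (pE : p%:num = 41 / 50) (qE : q%:num = 32 / 25).
Local Notation beta := (beta_distribution p q : probability (measurableTypeR R) R).
Local Notation I01 := (`]0%R, 1%R[%classic : set (measurableTypeR R)).

Lemma moments_example : [/\ moment beta 1 = 41 / 105,
  moment beta 2 = 91 / 155 * moment beta 1,
  moment beta 3 = 141 / 205 * moment beta 2 &
  moment beta 4 = 191 / 255 * moment beta 3].
Proof.
(* [x / y] is the ratio [(p + n) / (p + n + q)] in lowest terms, checked by cross-multiplication. *)
have S n (x y : R) : 0 < y -> (41 / 50 + n%:R) * y = (41 / 50 + n%:R + 32 / 25) * x ->
    moment beta n.+1 = x / y * moment beta n.
  move=> y0 xy; rewrite moment_betaS pE qE; congr (_ * _).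
  have s0 : 0 < 41 / 50 + n%:R + 32 / 25 :> R by have := ler0n R n; lra.
  apply/eqP; rewrite eqr_div ?(gt_eqF y0) ?(gt_eqF s0)//; apply/eqP; lra.
split; first by rewrite (S 0%N 41 105) ?moment_beta0 ?mulr1//; lra.
- by apply: S => //; lra.
- by apply: S => //; lra.
- by apply: S => //; lra.
Qed.

Lemma not_fid_example : ~ freely_infinitely_divisible beta.
Proof.
move=> fid; have [e1 e2 e3 e4] := moments_example.
have mI : measurable I01 by exact: measurable_itv.
have D1 x : I01 x -> `|x| <= 1.
  by rewrite /= in_itv /= ler_norml => /andP[? ?]; apply/andP; split; lra.
have Dm x : I01 x -> `|x - moment beta 1| <= 1.
  by rewrite /= in_itv /= ler_norml e1 => /andP[? ?]; apply/andP; split; lra.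
have b01 := beta_distribution01 p q.
have [c1 c2 c3 c4] := central_moments_le4 mI b01 D1.
(* At [a = - k3], [b = k2] the form equals [k2 (k2 (k4 + k2^2 / 10) - k3^2)], that is [k2] times its
   determinant. *)
have := fid_hankel mI b01 Dm c1 (isT : (1 < 10)%N) fid
  (- central_moment beta (moment beta 1) 3) (central_moment beta (moment beta 1) 2).
rewrite c2 c3 c4 e4 e3 e2 e1.
lra.
Qed.

(** Taking [a = 0] in the Hankel inequality for all [n] only yields [k4 >= 0]; positivity here shows
    that this simpler criterion does not detect the example, and that the determinant is
    essential. *)
Lemma kappa4_example : 0 < free_cumulant beta 4.
Proof.
have [e1 e2 e3 e4] := moments_example.
rewrite /free_cumulant free_cumulant4 e4 e3 e2 e1.
lra.
Qed.

End example.

(** * A box of parameters outside the known regions *)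

Section regions_example.
Variable R : realType.
Implicit Types p q : R.

(** On the box [s] lies in [(2.08, 2.12)] and [p q >= 1]; the positive part of [Psi] is at most 60
    and the factor of [p q] at most -65. *)
Lemma Psi_lt0_example p q : 81/100 < p < 83/100 -> 127/100 < q < 129/100 -> Psi p q < 0.
Proof.
move=> /andP[p1 p2] /andP[q1 q2]; rewrite /Psi; cbv zeta.
have pq : 1 <= p * q by nra.
have : 208/100 < p + q by lra.
have : p + q < 212/100 by lra.
move: (p + q) => s s2 s1.
have s3 : s ^+ 2 <= 45/10 by nra.
have s4 : 432/100 <= s ^+ 2 by nra.
have s5 : s ^+ 3 <= 954/100 by rewrite exprS; nra.
have s6 : 2 * s ^+ 3 * (s + 1) <= 60.
  have : 0 <= s ^+ 3 by rewrite exprn_ge0//; lra.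
  by nra.
have T : s ^+ 3 - 7 * s ^+ 2 - 16 * s - 12 <= -65 by lra.
by nra.
Qed.

(** [p] lies in the gap [[4/5, 5/6]] between the second and third intervals of the first family; the
    second family lies above 1. *)
Lemma I_set_left p : 81/100 < p < 83/100 -> ~ I_set p.
Proof.
move=> /andP[p1 p2] [] [n /= n1]; rewrite in_itv /=.
  have N1 : 1 <= n%:R :> R by rewrite ler1n.
  rewrite ltr_pdivrMr ?ltr_pdivlMr; [|lra|lra] => /andP[h1 h2].
  case: n n1 h1 h2 N1 => [//|[|[|n]]] _ h1 h2 N1; [lra|lra|].
  have : 3 <= n.+3%:R :> R by rewrite ler_nat.
  nra.
have N1 : 1 <= n%:R :> R by rewrite ler1n.
by rewrite ltr_pdivrMr; [|lra] => /andP[h1 _]; nra.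
Qed.

(** [q] lies in the gap [[5/4, 4/3]] between the first two intervals of the second family; the first
    family lies below 1. *)
Lemma I_set_right q : 127/100 < q < 129/100 -> ~ I_set q.
Proof.
move=> /andP[p1 p2] [] [n /= n1]; rewrite in_itv /=.
  have N1 : 1 <= n%:R :> R by rewrite ler1n.
  by rewrite ltr_pdivlMr; [|lra] => /andP[_ h1]; nra.
have N1 : 1 <= n%:R :> R by rewrite ler1n.
rewrite ltr_pdivrMr ?ltr_pdivlMr; [|lra|lra] => /andP[h1 h2].
case: n n1 h1 h2 N1 => [//|[|n]] _ h1 h2 N1; first lra.
have : 2 <= n.+2%:R :> R by rewrite ler_nat.
nra.
Qed.

End regions_example.

Theorem corollary4p1 (R : realType) :
  (exists U : set (R * R),
     [/\ open U,
         U !=set0,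
         U `<=` [set x | [/\ 0 < x.1, 0 < x.2 & Psi x.1 x.2 < 0]] &
         forall p q : R, U (p, q) ->
           [/\ ~ (p <= 1 /\ q <= 1),
               ~ I_set p /\ ~ I_set q,
               p <> q &
               p + q <> 2]]) /\
  ~ freely_infinitely_divisible
      (beta_distribution (41 / 50)%:pos (32 / 25)%:pos : probability _ R) /\
  0 < free_cumulant (beta_distribution (41 / 50)%:pos (32 / 25)%:pos : probability _ R) 4.
Proof.
split; last by split; [apply: not_fid_example|apply: kappa4_example].
(* The box of half-width 1/100 around the point [(41/50, 32/25)]; on it [p < 1 < q] and
   [p + q > 2]. *)
exists (`]81/100, 83/100[%classic `*` `]127/100, 129/100[%classic); split.
- rewrite openE => -[x y] [/= xA yB].
  exists (`]81/100, 83/100[%classic, `]127/100, 129/100[%classic) => //=.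
  by split; apply: open_nbhs_nbhs; split => //; exact: itv_open.
- by exists (82/100, 128/100); split => /=; rewrite in_itv /=; apply/andP; split; lra.
- move=> [p q] [/=]; rewrite !in_itv /= => hp hq.
  by have := Psi_lt0_example hp hq; move: hp hq => /andP[? ?] /andP[? ?]; split => //; lra.
- move=> p q [/=]; rewrite !in_itv /= => hp hq.
  have := I_set_right hq; have := I_set_left hp.
  move: hp hq => /andP[? ?] /andP[? ?] ip iq.
  by split; [move=> []; lra|split|lra|lra].
Qed.
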